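(* Let $R$ be a commutative Noetherian local ring, and let $M$ be a non-zero finitely generated $R$-module with $\operatorname{qpd}_R M<\infty$. Then the following statements hold: (1) If $M$ is Cohen-Macaulay, then $M$ is quasi-perfect. (2) If $R$ is Cohen-Macaulay and $M$ is quasi-perfect, then $M$ is Cohen-Macaulay.
   Context: $\operatorname{grade} M:=\inf\{i\ge 0:\operatorname{Ext}^i_R(M,R)\ne 0\}$. For a complex $X$ of $R$-modules (homologically indexed), $\sup X=\sup\{i: X_i\ne 0\}$, $\inf X=\inf\{i: X_i\neq 0\}$, $\operatorname{hsup}X=\sup\{i: H_i(X)\neq 0\}$. $X$ is bounded below if $\inf X>-\infty$, and bounded if $\sup X-\inf X<\infty$. A quasi-projective resolution of $M$ is a bounded below complex $P$ of (finitely generated) projective $R$-modules such that for all $i\ge\inf P$ there exist non-negative integers $a_i$, not all zero, with $H_i(P)\cong M^{\oplus a_i}$. The quasi-projective dimension of $M\neq 0$ is $\operatorname{qpd}_R M=\inf\{\sup P-\operatorname{hsup}P : P \text{ is a bounded quasi-projective resolution of } M\}$; it is $\infty$ if $M$ has no bounded quasi-projective resolution. $M$ is called quasi-perfect if $\operatorname{qpd}_R M<\infty$ and $\operatorname{qpd}_R M=\operatorname{grade} M$. *)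

(* Defs.v *)
From HB Require Import structures.
From mathcomp Require Import all_boot all_order all_algebra.
From mathcomp Require Import ring_quotient zify.
From mathcomp Require Import boolp classical_sets constructive_ereal.

Set Implicit Arguments.
Unset Strict Implicit.
Unset Printing Implicit Defensive.

Import Order.TTheory GRing.Theory Num.Theory.
Local Open Scope ring_scope.

Local Open Scope classical_set_scope.

Fact supremums_int_neq0 (A : set (\bar int)) : supremums A !=set0.
Proof.
have lubI x : ubound A x -> (forall y, ubound A y -> (x <= y)%E) ->
  supremums A !=set0.
  by move=> ux lx; exists x; split.
have [[z uz]|nuz] := pselect (exists z : int, ubound A z%:E); last first.
  apply: (lubI +oo%E) => [x _|[r||] uy //]; first exact: leey.
    by case: nuz; exists r.
  by case: nuz; exists 0 => x /uy; rewrite leeNy_eq => /eqP ->; rewrite leNye.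
have [[a Aa]|na] := pselect (exists a : int, A a%:E); last first.
  apply: (lubI -oo%E) => [[r||] Ax|y _]; rewrite ?leNye ?lexx//.
    by case: na; exists r.
  by have := uz _ Ax.
pose Q k := `[< ubound A (z - k%:Z)%:E >].
have Q0 : exists k, Q k by exists 0%N; apply/asboolP; rewrite subr0.
have Qle k : Q k -> (k <= `|z - a|)%N.
  by move=> /asboolP /(_ _ Aa); rewrite lee_fin; lia.
case: (ex_maxnP Q0 Qle) => k /asboolP uk kmax.
apply: (lubI (z - k%:Z)%:E) => // -[r||] uy; rewrite ?leey//;
  last by have := uy _ Aa.
rewrite lee_fin leNgt; apply/negP => rk.
have : Q k.+1.
  apply/asboolP => x /uy /le_trans; apply; rewrite lee_fin; lia.
by move=> /kmax; rewrite ltnn.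
Qed.

(* [supremum] and [infimum] return their first argument on the empty set; by
   [supremums_int_neq0], applied to A or to -A, their value is the genuine
   least upper or greatest lower bound in all other cases.                    *)
Definition esup (A : set (\bar int)) : \bar int := supremum -oo%E A.
Definition einf (A : set (\bar int)) : \bar int := infimum +oo%E A.

Section Submodule.
Variables (R : comNzRingType) (V : lmodType R) (N : submodClosed V).

Record submod := Submod { submod_val : V; submod_valP : submod_val \in N }.

HB.instance Definition _ := [isSub for submod_val].
HB.instance Definition _ := [Choice of submod by <:].
HB.instance Definition _ := [SubChoice_isSubLmodule of submod by <:].

End Submodule.

Section QuotientModule.
Variables (R : comNzRingType) (V : lmodType R) (N : submodClosed V).

Definition quot_ker : {pred V} := [pred v | v \in N].
HB.instance Definition _ :=
  GRing.isZmodClosed.Build V quot_ker (GRing.submod_closedB (submodClosedP N)).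

(* V / N; mathcomp only provides its additive group structure. *)
Definition quotmod := Quotient.quot quot_ker.
HB.instance Definition _ := GRing.Zmodule.on quotmod.

Definition quotmod_pi (v : V) : quotmod := (\pi_(Quotient.quot quot_ker) v)%qT.
Definition quotmod_scale (a : R) (x : quotmod) : quotmod :=
  quotmod_pi (a *: (repr x : V)).

Fact quotmod_piP (u v : V) : (quotmod_pi u = quotmod_pi v) <-> (u - v \in N).
Proof.
rewrite -[u - v \in N]/(u - v \in quot_ker) Quotient.idealrBE.
by split => [/eqP|/eqP].
Qed.

Fact quotmod_reprK (x : quotmod) : quotmod_pi (repr x) = x.
Proof. exact: reprK. Qed.

Fact quotmod_piD (u v : V) : quotmod_pi (u + v) = quotmod_pi u + quotmod_pi v.
Proof. exact: (Quotient.pi_add quot_ker). Qed.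

Fact quotmod_piZ (a : R) (v : V) :
  quotmod_scale a (quotmod_pi v) = quotmod_pi (a *: v).
Proof.
by apply/quotmod_piP; rewrite -scalerBr rpredZ//; apply/quotmod_piP/quotmod_reprK.
Qed.

Fact quotmod_scaleA (a b : R) (x : quotmod) :
  quotmod_scale a (quotmod_scale b x) = quotmod_scale (a * b) x.
Proof. by rewrite -[x]quotmod_reprK !quotmod_piZ scalerA. Qed.

Fact quotmod_scale1 : left_id 1 quotmod_scale.
Proof. by move=> x; rewrite -[x]quotmod_reprK quotmod_piZ scale1r. Qed.

Fact quotmod_scaleDr : right_distributive quotmod_scale +%R.
Proof.
move=> a x y; rewrite -[x]quotmod_reprK -[y]quotmod_reprK -quotmod_piD.
by rewrite !quotmod_piZ scalerDr quotmod_piD.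
Qed.

Fact quotmod_scaleDl (x : quotmod) :
  {morph quotmod_scale^~ x : a b / a + b}.
Proof.
by move=> a b; rewrite -[x]quotmod_reprK !quotmod_piZ scalerDl quotmod_piD.
Qed.

HB.instance Definition _ := GRing.Zmodule_isLmodule.Build R quotmod
  quotmod_scaleA quotmod_scale1 quotmod_scaleDr quotmod_scaleDl.

End QuotientModule.

Section HomModule.
Variables (R : comNzRingType) (U V : lmodType R).

Definition homM := {linear U -> V}.
HB.instance Definition _ := gen_eqMixin homM.
HB.instance Definition _ := gen_choiceMixin homM.

Fact homMP (f g : homM) : (f : U -> V) =1 g -> f = g.
Proof.
case: f g => [f [[fA] [fZ]]] [g [[gA] [gZ]]] /= /funext fg; subst g.
by rewrite (Prop_irrelevance fA gA) (Prop_irrelevance fZ gZ).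
Qed.

Definition homM_zero : homM := (\0 : U -> V).
Definition homM_opp (f : homM) : homM := (\- f : U -> V).
Definition homM_add (f g : homM) : homM := (f \+ g : U -> V).
Definition homM_scale (a : R) (f : homM) : homM := (a \*: f : U -> V).

Fact homM_addA : associative homM_add.
Proof. by move=> f g h; apply: homMP => x /=; rewrite addrA. Qed.
Fact homM_addC : commutative homM_add.
Proof. by move=> f g; apply: homMP => x /=; rewrite addrC. Qed.
Fact homM_add0 : left_id homM_zero homM_add.
Proof. by move=> f; apply: homMP => x /=; rewrite add0r. Qed.
Fact homM_addN : left_inverse homM_zero homM_opp homM_add.
Proof. by move=> f; apply: homMP => x /=; rewrite addNr. Qed.

HB.instance Definition _ := GRing.isZmodule.Build homM
  homM_addA homM_addC homM_add0 homM_addN.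

Fact homM_scaleA (a b : R) (f : homM) :
  homM_scale a (homM_scale b f) = homM_scale (a * b) f.
Proof. by apply: homMP => x /=; rewrite scalerA. Qed.
Fact homM_scale1 : left_id 1 homM_scale.
Proof. by move=> f; apply: homMP => x /=; rewrite scale1r. Qed.
Fact homM_scaleDr : right_distributive homM_scale +%R.
Proof. by move=> a f g; apply: homMP => x /=; rewrite scalerDr. Qed.
Fact homM_scaleDl (f : homM) : {morph homM_scale^~ f : a b / a + b}.
Proof. by move=> a b; apply: homMP => x /=; rewrite scalerDl. Qed.

HB.instance Definition _ := GRing.Zmodule_isLmodule.Build R homM
  homM_scaleA homM_scale1 homM_scaleDr homM_scaleDl.

End HomModule.

Section Modules.
Variable R : comNzRingType.
Implicit Types U V M P : lmodType R.

Definition zero_module V : Prop := forall v : V, v = 0.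

Definition isomorphic U V : Prop := exists f : {linear U -> V}, bijective f.

Definition finitely_generated V : Prop :=
  exists (n : nat) (g : 'I_n -> V),
    forall v, exists c : 'I_n -> R, v = \sum_(i < n) c i *: g i.

Definition projective P : Prop :=
  forall (A B : lmodType R) (g : {linear A -> B}) (f : {linear P -> B}),
    (forall b, exists a, g a = b) ->
    exists h : {linear P -> A}, forall x, g (h x) = f x.

End Modules.

(* The differential is given as a family d i j : X_i -> X_j that vanishes
   unless i = j + 1, so that the indices never have to be transported along
   an equality such as (i + 1) - 1 = i.                                       *)
Record complex (R : comNzRingType) := Complex {
  obj :> int -> lmodType R;
  cdiff : forall i j, {linear obj i -> obj j};
  cdiff_shape : forall i j, i != j + 1 -> forall x, cdiff i j x = 0;
  cdiffK : forall i j k x, cdiff j k (cdiff i j x) = 0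
}.

Section Homology.
Variables (R : comNzRingType) (X : complex R) (i : int).

Definition cycles : {pred X i} := [pred x | cdiff X i (i - 1) x == 0].

Fact cycles_submod_closed : submod_closed cycles.
Proof.
split=> [|a u v]; rewrite !inE ?linear0// => /eqP u0 /eqP v0.
by rewrite linearP u0 v0 scaler0 addr0.
Qed.
HB.instance Definition _ :=
  GRing.isSubmodClosed.Build R (X i) cycles cycles_submod_closed.

Definition boundaries : {pred submod cycles} :=
  [pred z | `[< exists y, cdiff X (i + 1) i y = \val z >]].

Fact boundaries_submod_closed : submod_closed boundaries.
Proof.
split=> [|a u v]; first by apply/asboolP; exists 0; rewrite !linear0.
move=> /asboolP[x xu] /asboolP[y yv]; apply/asboolP.
by exists (a *: x + y); rewrite linearP xu yv.
Qed.
HB.instance Definition _ :=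
  GRing.isSubmodClosed.Build R (submod cycles) boundaries
    boundaries_submod_closed.

Definition homology : lmodType R := quotmod boundaries.

End Homology.

Section HomComplex.
Variables (R : comNzRingType) (X : complex R) (N : lmodType R).

(* Hom_R(X, N), reindexed homologically: degree j is Hom_R(X_{-j}, N). *)
Definition hom_obj (j : int) : lmodType R := homM (X (- j)) N.

Definition hom_diff_fun (j k : int) (f : hom_obj j) : hom_obj k :=
  ((f : {linear X (- j) -> N}) \o cdiff X (- k) (- j) : X (- k) -> N).

Fact hom_diff_linear (j k : int) : linear (@hom_diff_fun j k).
Proof. by move=> a f g; apply: homMP => x. Qed.
HB.instance Definition _ (j k : int) :=
  GRing.isLinear.Build R (hom_obj j) (hom_obj k) *:%R (@hom_diff_fun j k)
    (@hom_diff_linear j k).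

Definition hom_diff (j k : int) : {linear hom_obj j -> hom_obj k} :=
  @hom_diff_fun j k.

Fact hom_diff_shape (j k : int) :
  j != k + 1 -> forall f, hom_diff j k f = 0.
Proof.
move=> jk f; apply: homMP => x /=; rewrite cdiff_shape ?linear0//.
by apply: contra jk => /eqP e; apply/eqP; rewrite -[j]opprK -[k]opprK e opprD addrNK.
Qed.

Fact hom_diffK (i j k : int) f : hom_diff j k (hom_diff i j f) = 0.
Proof. by apply: homMP => x /=; rewrite cdiffK linear0. Qed.

Definition hom_complex : complex R := Complex hom_diff_shape hom_diffK.

End HomComplex.

Section Invariants.
Variable R : comNzRingType.
Implicit Types (X P F : complex R) (M N : lmodType R).

Definition csup X : \bar int :=
  esup [set e | exists2 i : int, ~ zero_module (X i) & e = i%:E].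
Definition cinf X : \bar int :=
  einf [set e | exists2 i : int, ~ zero_module (X i) & e = i%:E].
Definition hsup X : \bar int :=
  esup [set e | exists2 i : int, ~ zero_module (homology X i) & e = i%:E].

Definition bounded_below X : Prop := (-oo < cinf X)%E.
Definition bounded X : Prop := (csup X - cinf X < +oo)%E.

Definition quasi_projective_resolution P M : Prop :=
  [/\ bounded_below P,
      forall i, finitely_generated (P i) /\ projective (P i) &
      exists a : int -> nat,
        (exists2 i : int, (cinf P <= i%:E)%E & a i <> 0%N) /\
        forall i : int, (cinf P <= i%:E)%E ->
          isomorphic (homology P i) {ffun 'I_(a i) -> M}].

Definition qpd M : \bar int :=
  einf [set e | exists P, [/\ quasi_projective_resolution P M, bounded P
                            & e = (csup P - hsup P)%E]].

Definition projective_resolution F M : Prop :=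
  [/\ forall i, i < 0 -> zero_module (F i),
      forall i, projective (F i),
      forall i, i != 0 -> zero_module (homology F i)
    & isomorphic (homology F 0) M].

(* E is (a model of) Ext^i_R(M, N); it does not depend, up to isomorphism, on
   the projective resolution.                                                 *)
Definition is_Ext (i : nat) M N (E : lmodType R) : Prop :=
  exists2 F, projective_resolution F M
           & isomorphic E (homology (hom_complex F N) (- i%:Z)).

Definition grade M : \bar int :=
  einf [set e | exists i : nat,
    (exists2 E, is_Ext i M R^o E & ~ zero_module E) /\ e = i%:Z%:E].

Definition quasi_perfect M : Prop := (qpd M < +oo)%E /\ qpd M = grade M.

End Invariants.

Section CohenMacaulay.
Variable R : comNzRingType.
Implicit Types (m p : {pred R}) (M : lmodType R).

Definition noetherian : Prop :=
  forall I : submodClosed R^o, finitely_generated (submod I).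

(* [idealr_closed] includes properness. *)
Definition maximal_ideal m : Prop :=
  idealr_closed m /\
  forall J : {pred R}, idealr_closed J -> {subset m <= J} -> J =i m.

Definition local_ring m : Prop :=
  maximal_ideal m /\ forall n : {pred R}, maximal_ideal n -> n =i m.

Definition prime_ideal p : Prop := idealr_closed p /\ prime_idealr_closed p.

Definition ann M : set R := [set a | forall v : M, a *: v = 0].

(* The Krull dimension of R / ann M: the primes of that quotient are the primes
   of R that contain ann M.                                                   *)
Definition dim M : \bar int :=
  esup [set e | exists n : nat, e = n%:Z%:E /\
    exists p : 'I_n.+1 -> {pred R},
      (forall i, prime_ideal (p i) /\ forall a, ann M a -> a \in p i) /\
      forall i j : 'I_n.+1, (i < j)%N ->
        {subset p i <= p j} /\ ~ {subset p j <= p i}].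

(* The submodule (s_0, ..., s_(n-1)) M. *)
Definition seq_mul (s : seq R) M : set M :=
  [set v | exists c : 'I_(size s) -> M, v = \sum_(i < size s) s`_i *: c i].

Definition regular_seq (s : seq R) M : Prop :=
  (forall i, (i < size s)%N -> forall v : M,
     seq_mul (take i s) (s`_i *: v) -> seq_mul (take i s) v) /\
  exists v : M, ~ seq_mul s v.

Definition depth m M : \bar int :=
  esup [set e | exists s : seq R,
    [/\ {subset s <= m}, regular_seq s M & e = (size s)%:Z%:E]].

Definition cohen_macaulay m M : Prop := depth m M = dim M.

End CohenMacaulay.

(* Main.v *)
(** Write r = depth R, d = depth M, g = grade M.  A quasi-projective resolution P
    of M with top degree t and top homology degree s is studied by killing
    elements x of the maximal ideal that are regular on R.  If x is also regular
    on M, every homology module is replaced by its quotient by x; if instead the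
    top homology H_s has a socle, or is annihilated by x, the connecting map
    embeds that part of H_s as the new top homology in degree s + 1.  Killing
    first a common regular sequence of R and M and then the rest of a maximal
    regular sequence of R gives t - s >= r - d, with equality when the
    differential leaving P_t is minimal (in the weak sense that some unimodular
    element of P_t is sent into m P_(t-1)); minimality is reached by splitting
    off summands R u -> R (d u).  An R-regular sequence of length g
    in ann M exists by Rees' theorem, and killing it gives t - s >= g.
    Finally r - g <= dim M, by the chain of primes above an associated prime of
    R/(x_1, ..., x_g), and dim M + g <= dim R, by extending chains of primes
    below.  For M Cohen-Macaulay this yields g <= qpd M <= r - d <= g; for R
    Cohen-Macaulay and qpd M = g it yields d >= r - g >= dim M.                *)
From HB Require Import structures.
Require Import Defs.
From mathcomp Require Import all_boot all_order all_algebra.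
From mathcomp Require Import ring zify.
From mathcomp Require Import boolp classical_sets constructive_ereal.

Set Implicit Arguments.
Unset Strict Implicit.
Unset Printing Implicit Defensive.

Import Order.TTheory GRing.Theory Num.Theory.
Local Open Scope ring_scope.

(** After x is killed, the terms of P are projective only over R/x. To stay over the ring R
    throughout, the terms are only required to be direct summands of powers of a module N, which
    starts as R and becomes N/x at each reduction; minimality is likewise phrased relative to N. The
    shift of the top homology comes from the long exact sequence of 0 -> X -> X -> X/x -> 0: when
    H_(s+1)(X) = 0, the connecting map identifies H_(s+1)(X/x) with the elements of H_s(X) killed by
    x. The top degree t never moves, so every such shift is a constraint on t - s. Once N has depth
    0, a minimal top term contains a copy of a socle element of N as a cycle, so the top homology
    sits exactly in degree t: this is the source of the equality. Depth is handled as a recursive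
    predicate. Its independence of the regular sequence rests on exchanging socle elements between
    V/x and V/y, both socles being Ext^1(k, V) in disguise. *)

(** * Submodules as predicates, and quotients up to isomorphism *)

Section Submodules.
Variable R : comNzRingType.
Implicit Types (U V W : lmodType R).

Lemma linear_of_fun V W (f : V -> W) :
  linear f -> exists g : {linear V -> W}, g =1 f.
Proof.
move=> fL; pose F := GRing.isLinear.Build R V W *:%R f fL.
by exists (HB.pack_for {linear V -> W} f F).
Qed.

(** A bare [Prop]-valued predicate, so that submodules can be quantified over and given by
    existential formulas; [subm_pred] bundles it where a [submodClosed] structure is required. *)
Definition subm V (S : V -> Prop) : Prop :=
  S 0 /\ forall a u v, S u -> S v -> S (a *: u + v).

Definition subm_pred V (S : V -> Prop) (HS : subm S) : {pred V} :=
  fun v => `[< S v >].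

Fact subm_pred_closed V (S : V -> Prop) (HS : subm S) :
  submod_closed (subm_pred HS).
Proof.
case: (HS) => S0 SD; split; first exact/asboolP.
by move=> a u v /asboolP Su /asboolP Sv; apply/asboolP/SD.
Qed.
HB.instance Definition _ V (S : V -> Prop) (HS : subm S) :=
  GRing.isSubmodClosed.Build R V (subm_pred HS) (subm_pred_closed HS).

Section Closure.
Variables (V : lmodType R) (S : V -> Prop).
Hypothesis HS : subm S.

Lemma submD u v : S u -> S v -> S (u + v).
Proof. by move=> Su Sv; rewrite -[u]scale1r; apply: HS.2. Qed.

Lemma submZ a u : S u -> S (a *: u).
Proof. by move=> Su; rewrite -[_ *: _]addr0; apply: HS.2 => //; apply: HS.1. Qed.

Lemma submN u : S u -> S (- u).
Proof. by move=> Su; rewrite -scaleN1r; apply: submZ. Qed.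

Lemma submB u v : S u -> S v -> S (u - v).
Proof. by move=> Su Sv; apply: submD => //; apply: submN. Qed.

Lemma subm_sum (I : finType) (F : I -> V) :
  (forall i, S (F i)) -> S (\sum_i F i).
Proof.
by move=> SF; elim/big_ind: _ => //; [apply: HS.1|apply: submD].
Qed.

End Closure.

(* pi presents W as V / S; working with an arbitrary such pi makes invariance
   under isomorphism automatic.                                               *)
Definition quotient_map V W (S : V -> Prop) (pi : {linear V -> W}) : Prop :=
  (forall w, exists v, pi v = w) /\ forall v, pi v = 0 <-> S v.

Lemma quotient_ex V (S : V -> Prop) : subm S ->
  exists (W : lmodType R) (pi : {linear V -> W}), quotient_map S pi.
Proof.
move=> HS; pose W : lmodType R := quotmod (subm_pred HS).
have [|pi piE] := @linear_of_fun V W (@quotmod_pi R V (subm_pred HS)).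
  by move=> a u v; rewrite quotmod_piD -quotmod_piZ.
exists W, pi; split.
  by move=> w; exists (repr w); rewrite piE; apply: quotmod_reprK.
move=> v; rewrite -(linear0 pi) !piE; split.
  by move=> /quotmod_piP; rewrite subr0 => /asboolP.
by move=> Sv; apply/quotmod_piP; rewrite subr0; apply/asboolP.
Qed.

Lemma quotient_map_eq V W (S : V -> Prop) (pi : {linear V -> W}) :
  quotient_map S pi -> forall u v, pi u = pi v <-> S (u - v).
Proof.
move=> [_ ker] u v; rewrite -ker linearB; split => [->|/eqP]; first by rewrite subrr.
by rewrite subr_eq0 => /eqP.
Qed.

Lemma quotient_lift U V W (S : V -> Prop) (pi : {linear V -> W})
    (f : {linear V -> U}) :
  quotient_map S pi -> (forall v, S v -> f v = 0) ->
  exists f' : {linear W -> U}, forall v, f' (pi v) = f v.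
Proof.
move=> qpi fS; have [s sK] := choice qpi.1.
have fsE v : f (s (pi v)) = f v.
  apply/eqP; rewrite -subr_eq0 -linearB; apply/eqP/fS.
  by apply/(quotient_map_eq qpi); rewrite sK.
have [|f' f'E] := @linear_of_fun _ _ (f \o s).
  move=> a u v /=; rewrite -linearP; rewrite -[LHS]fsE -[RHS]fsE sK.
  by rewrite linearP !sK.
by exists f' => v; rewrite f'E /= fsE.
Qed.

End Submodules.

(** * Spans, finite generation and the maximal condition *)

Section Noetherian.
Variable R : comNzRingType.
Implicit Types (U V W : lmodType R).

(** Peeling off one generator at a time is the form used by all inductions on generators, such as
    [subm_span], [nakayama] and [span_exchange]. *)
Fixpoint span V (l : seq V) (v : V) : Prop :=
  if l is g :: l' then exists a : R, span l' (v - a *: g) else v = 0.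

Lemma span_subm V (l : seq V) : subm (span l).
Proof.
elim: l => [|g l IH]; split => [|a u v] //=.
- by move=> -> ->; rewrite scaler0 addr0.
- by exists 0; rewrite scale0r subr0; apply: IH.1.
- move=> [b Hb] [c Hc]; exists (a * b + c).
  have -> : a *: u + v - (a * b + c) *: g = a *: (u - b *: g) + (v - c *: g).
    by rewrite scalerDl scalerBr scalerA opprD addrACA.
  exact: IH.2.
Qed.

Lemma span_cons V (g : V) l v : span l v -> span (g :: l) v.
Proof. by exists 0; rewrite scale0r subr0. Qed.

Lemma span_mem V (l : seq V) v : v \in l -> span l v.
Proof.
elim: l => // g l IH; rewrite inE => /orP[/eqP ->|/IH]; last exact: span_cons.
by exists 1; rewrite scale1r subrr; apply: (span_subm l).1.
Qed.

Lemma span_min V (l : seq V) (S : V -> Prop) : subm S ->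
  (forall v, v \in l -> S v) -> forall v, span l v -> S v.
Proof.
move=> HS; elim: l => [|g l IH] lS v /=; first by move=> ->; apply: HS.1.
case=> a /IH Sva; rewrite -(subrK (a *: g) v); apply: submD => //.
  by apply: Sva => w wl; apply: lS; rewrite inE wl orbT.
by apply: submZ => //; apply: lS; rewrite mem_head.
Qed.

Lemma span_sub V (l k : seq V) : {subset l <= k} ->
  forall v, span l v -> span k v.
Proof.
by move=> lk; apply: span_min (span_subm k) _ => v /lk; apply: span_mem.
Qed.

Lemma spanP V (l : seq V) v :
  span l v <-> exists c : 'I_(size l) -> R, v = \sum_i c i *: l`_i.
Proof.
split=> [|[c ->]]; last first.
  apply: subm_sum => [|i]; first exact: span_subm.
  by apply: submZ; [exact: span_subm|apply/span_mem/mem_nth].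
elim: l v => [|g l IH] v /=.
  by move=> ->; exists (fun=> 0); rewrite big_ord0.
move=> [a /IH[c vE]].
exists (fun i => if unlift ord0 i is Some j then c j else a).
rewrite big_ord_recl unlift_none /= -(subrK (a *: g) v) vE addrC.
by congr (_ + _); apply: eq_bigr => i _; rewrite liftK.
Qed.

Lemma fg_spanP V :
  finitely_generated V <-> exists l : seq V, forall v, span l v.
Proof.
split=> [[n [g gP]]|[l lP]]; last first.
  by exists (size l), (fun i => l`_i) => v; apply/spanP.
exists (codom g) => v; have [c ->] := gP v.
apply: subm_sum => [|i]; first exact: span_subm.
by apply: submZ; [exact: span_subm|apply/span_mem/codom_f].
Qed.

Lemma fg_quotient V W (S : V -> Prop) (pi : {linear V -> W}) :
  quotient_map S pi -> finitely_generated V -> finitely_generated W.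
Proof.
move=> [piS _] /fg_spanP[l lP]; apply/fg_spanP; exists (map pi l) => w.
have [v <-] := piS w; move: (lP v).
apply: (@span_min _ _ (fun v => span (map pi l) (pi v))) => [|u ul].
  split; first by rewrite linear0; apply: (span_subm _).1.
  by move=> a x y; rewrite linearP; apply: (span_subm _).2.
by apply/span_mem/map_f.
Qed.

Lemma fg_prod V W : finitely_generated V -> finitely_generated W ->
  finitely_generated (V * W)%type.
Proof.
move=> /fg_spanP[l lP] /fg_spanP[k kP]; apply/fg_spanP.
pose f (v : V) : (V * W)%type := (v, 0); pose g (w : W) : (V * W)%type := (0, w).
exists (map f l ++ map g k) => -[v w].
have -> : (v, w) = f v + g w by rewrite /f /g; congr pair; rewrite ?addr0 ?add0r.
have HS := span_subm (map f l ++ map g k).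
apply: submD => //.
  move: (lP v); apply: (@span_min _ _ (fun v => span _ (f v))) => [|u ul].
    split; first exact: HS.1.
    move=> a x y fx fy; suff -> : f (a *: x + y) = a *: f x + f y by apply: HS.2.
    by congr pair; rewrite /= scaler0 addr0.
  by apply: span_mem; rewrite mem_cat map_f.
move: (kP w); apply: (@span_min _ _ (fun w => span _ (g w))) => [|u ul].
  split; first exact: HS.1.
  move=> a x y fx fy; suff -> : g (a *: x + y) = a *: g x + g y by apply: HS.2.
  by congr pair; rewrite /= scaler0 addr0.
by apply: span_mem; rewrite mem_cat map_f ?orbT.
Qed.

Lemma fg_regular : finitely_generated (R^o : lmodType R).
Proof.
exists 1%N, (fun=> 1) => v; exists (fun=> v).
by rewrite big_ord1 /GRing.scale /= mulr1.
Qed.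

Lemma fg_submod_span V (S : V -> Prop) (HS : subm S) :
  finitely_generated (submod (subm_pred HS)) ->
  exists l : seq V, forall v, S v <-> span l v.
Proof.
move=> [n [g gP]].
have [|f fE] := @linear_of_fun _ (submod (subm_pred HS)) V (@submod_val _ _ _).
  by move=> a u v; rewrite -[LHS]/(val _) linearP.
have gS i : S (f (g i)) by rewrite fE; apply/asboolP/(submod_valP (g i)).
exists (codom (f \o g)) => v; split; last first.
  by apply: span_min => // _ /codomP[i ->]; apply: gS.
move=> Sv; have Sv' : v \in subm_pred HS by apply/asboolP.
have [c cE] := gP (Submod Sv').
have -> : v = \sum_i c i *: f (g i).
  transitivity (f (Submod Sv')); first by rewrite fE.
  by rewrite cE linear_sum; apply: eq_bigr => i _; rewrite linearZ.
apply: subm_sum => [|i]; first exact: span_subm.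
apply: submZ; first exact: span_subm.
exact/span_mem/(codom_f (f \o g)).
Qed.

Hypothesis Rnoeth : noetherian R.

Lemma ideal_span (I : R^o -> Prop) : subm I ->
  exists l : seq R^o, forall a, I a <-> span l a.
Proof. by move=> HI; apply: (fg_submod_span (Rnoeth (subm_pred HI))). Qed.

(** Induction on the generators of V. The coefficients of g in elements of S, taken modulo the span
    of l, form an ideal J; lifts to S of generators of J, together with generators of the
    intersection of S with the span of l, generate S. *)
Lemma subm_span V (S : V -> Prop) : finitely_generated V -> subm S ->
  exists l : seq V, forall v, S v <-> span l v.
Proof.
(* Only the inclusion of S in the span of l is kept, so that the induction hypothesis applies to a
   smaller S in the same ambient V. *)
move=> /fg_spanP[l lP] HS; have {lP} : forall v, S v -> span l v by [].
elim: l S HS => [|g l IH] S HS lP.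
  by exists [::] => v; split => [/lP//|->]; apply: HS.1.
have Hl := span_subm l.
pose J (a : R^o) := exists2 u, span l u & S (a *: g + u).
have HJ : subm J.
  split; first by exists 0; [exact: Hl.1|rewrite scale0r addr0; exact: HS.1].
  move=> a b c [u lu Su] [v lv Sv]; exists (a *: u + v); first exact: Hl.2.
  have -> : (a *: b + c) *: g + (a *: u + v) = a *: (b *: g + u) + (c *: g + v).
    by rewrite scalerDl scalerDr scalerA addrACA.
  exact: HS.2.
have [js jsP] := ideal_span HJ.
have [u uP] : {u : R^o -> V & forall a, J a -> span l (u a) /\ S (a *: g + u a)}.
  apply: (@choice _ _ (fun (a : R^o) v => J a -> span l v /\ S ((a : R) *: g + v))).
  move=> a; have [[v lv Sv]|nJ] := pselect (J a); first by exists v.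
  by exists 0.
have [|v Sv|k kP] := IH (fun v => S v /\ span l v).
- split; first by split; [exact: HS.1|exact: Hl.1].
  by move=> a v w [Sv lv] [Sw lw]; split; [exact: HS.2|exact: Hl.2].
- by case: Sv.
pose h := [seq (a : R) *: g + u a | a <- js] ++ k.
have Hh := span_subm h.
have hS w : span h w -> S w.
  apply: span_min => // {}w; rewrite mem_cat => /orP[/mapP[a ajs ->]|wk].
    by apply: (uP a _).2; apply/jsP/span_mem.
  exact: ((kP w).2 (span_mem wk)).1.
exists h => v; split; last exact: hS.
move=> Sv; have [a lva] := lP v Sv.
have /jsP Ja : J a by exists (v - a *: g) => //; rewrite addrC subrK.
have [w hw lw] : exists2 w, span h w & span l (w - (a : R) *: g).
  apply: (@span_min _ js (fun a : R^o =>
    exists2 w, span h w & span l (w - (a : R) *: g))) Ja => [|b bjs].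
    split; first by exists 0; [exact: Hh.1|rewrite scale0r subrr; exact: Hl.1].
    move=> c b1 b2 [w1 h1 l1] [w2 h2 l2]; exists (c *: w1 + w2); first exact: Hh.2.
    suff -> : c *: w1 + w2 - (c *: b1 + b2) *: g =
              c *: (w1 - b1 *: g) + (w2 - b2 *: g) by apply: Hl.2.
    by rewrite scalerDl scalerBr scalerA opprD addrACA.
  exists ((b : R) *: g + u b).
    apply: span_mem; rewrite mem_cat; apply/orP; left.
    exact: (map_f (fun a : R^o => (a : R) *: g + u a)).
  by rewrite addrAC subrr add0r; apply: (uP b _).1; apply/jsP/span_mem.
rewrite -(subrK w v); apply: submD => //.
apply: (@span_sub _ k) => [x xk|]; first by rewrite mem_cat xk orbT.
apply/kP; split; first by apply: submB => //; apply: hS.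
suff -> : v - w = (v - a *: g) - (w - a *: g) by apply: submB.
by rewrite opprB addrA subrK.
Qed.

(** Without a maximal member, iterating a chosen strict enlargement would give a strictly increasing
    sequence; its union is finitely generated, and the generators already lie in one of its
    terms. *)
Lemma ideal_max (F : (R^o -> Prop) -> Prop) :
  (forall I, F I -> subm I) -> (exists I, F I) ->
  exists2 I, F I & forall J, F J -> (forall a, I a -> J a) -> forall a, J a -> I a.
Proof.
move=> Fsub [I0 FI0]; apply: contrapT => nmax.
have [nxt nxtP] : {nxt : (R^o -> Prop) -> (R^o -> Prop) & forall I, F I ->
    [/\ F (nxt I), forall a, I a -> nxt I a & exists2 a, nxt I a & ~ I a]}.
  apply: (@choice _ _ (fun I J => F I ->
    [/\ F J, forall a, I a -> J a & exists2 a, J a & ~ I a])).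
  move=> I; have [FI|] := pselect (F I); last by exists I.
  apply: contrapT => nJ; apply: nmax; exists I => // J FJ IJ a Ja.
  by apply: contrapT => nIa; apply: nJ; exists J => _; split => //; exists a.
pose c n := iter n nxt I0.
have Fc n : F (c n) by elim: n => //= n /nxtP[].
have cS n : forall a, c n a -> c n.+1 a by have [] := nxtP _ (Fc n).
have cle i j : (i <= j)%N -> forall a, c i a -> c j a.
  by move=> /subnK <-; elim: (j - i)%N => // k IH a /IH; apply: cS.
pose U a := exists n, c n a.
have HU : subm U.
  split; first by exists 0%N; apply: (Fsub _ (Fc 0%N)).1.
  move=> a u v [i ui] [j vj]; exists (maxn i j); apply: (Fsub _ (Fc _)).2.
    by apply: cle ui; exact: leq_maxl.
  by apply: cle vj; exact: leq_maxr.
have [l lP] := ideal_span HU.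
have [n nP] : exists n, forall a, a \in l -> c n a.
  have : forall a, a \in l -> U a by move=> a al; apply/lP/span_mem.
  elim: l {lP} => [|g l IH] lU; first by exists 0%N.
  have [a al|i iP] := IH; first by apply: lU; rewrite inE al orbT.
  have [j gj] := lU g (mem_head _ _).
  exists (maxn i j) => a; rewrite inE => /orP[/eqP ->|/iP].
    by apply: cle gj; exact: leq_maxr.
  by apply: cle; exact: leq_maxl.
have [_ _ [a an na]] := nxtP _ (Fc n).
apply: na; apply: (span_min (Fsub _ (Fc n)) nP).
by apply/lP; exists n.+1.
Qed.

End Noetherian.

(** * Associated primes, zero divisors and prime avoidance *)

Section Avoidance.
Variable R : comNzRingType.
Implicit Types (U V W : lmodType R).

Definition regular_elt (x : R) V : Prop := forall v : V, x *: v = 0 -> v = 0.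

Definition multiples (x : R) V (v : V) : Prop := exists u : V, v = x *: u.

Lemma multiples_subm x V : subm (@multiples x V).
Proof.
split; first by exists 0; rewrite scaler0.
move=> a _ _ [u ->] [v ->]; exists (a *: u + v).
by rewrite scalerDr !scalerA mulrC.
Qed.

Lemma annihilator_subm V (v : V) : subm (fun a : R^o => (a : R) *: v = 0).
Proof.
split; first by rewrite scale0r.
by move=> a b c bv cv; rewrite scalerDl -scalerA bv cv scaler0 addr0.
Qed.

(** For v nonzero, the annihilator of v is an associated prime of V; such primes are carried by
    elements. *)
Definition prime_elt V (v : V) : Prop :=
  forall a b : R, (a * b) *: v = 0 -> a *: v = 0 \/ b *: v = 0.

Definition maximal_elt V (v : V) : Prop :=
  v <> 0 /\ forall u : V, u <> 0 -> (forall a, a *: v = 0 -> a *: u = 0) ->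
    forall a, a *: u = 0 -> a *: v = 0.

Lemma maximal_prime_elt V (v : V) : maximal_elt v -> prime_elt v.
Proof.
move=> [_ vmax] a b; have [->|/eqP bv] := eqVneq (b *: v) 0; first by right.
rewrite -scalerA => abv; left; apply: (vmax (b *: v)) => // c cv.
by rewrite scalerA mulrC -scalerA cv scaler0.
Qed.

(** The product of the individual scalars works: primality keeps it from killing v. *)
Lemma prime_elt_separate V (v : V) (l : seq V) : v <> 0 -> prime_elt v ->
  (forall w, w \in l -> exists2 a : R, a *: w = 0 & a *: v <> 0) ->
  exists2 a : R, (forall w, w \in l -> a *: w = 0) & a *: v <> 0.
Proof.
move=> v0 pv; elim: l => [|w l IH] lP; first by exists 1; rewrite ?scale1r.
have [|a al av] := IH; first by move=> u ul; apply: lP; rewrite inE ul orbT.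
have [b bw bv] := lP w (mem_head _ _); exists (a * b) => [u|/pv[]//].
rewrite inE => /orP[/eqP ->|/al au]; first by rewrite -scalerA bw scaler0.
by rewrite mulrC -scalerA au scaler0.
Qed.

Hypothesis Rnoeth : noetherian R.

Lemma maximal_elt_above V (v : V) : v <> 0 ->
  exists2 w : V, maximal_elt w & forall a, a *: v = 0 -> a *: w = 0.
Proof.
move=> v0; pose F (I : R^o -> Prop) := exists w : V,
  [/\ w <> 0, I = (fun a => (a : R) *: w = 0) & forall a, a *: v = 0 -> a *: w = 0].
have [||_ [w [w0 -> vw]] wmax] := ideal_max Rnoeth (F := F).
- by move=> _ [w [_ -> _]]; apply: annihilator_subm.
- by exists (fun a => (a : R) *: v = 0), v.
exists w => //; split => // u u0 wu a au.
by apply: (wmax (fun a => (a : R) *: u = 0)) => //; exists u; split => // b /vw/wu.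
Qed.

(** The submodule generated by all maximal elements is generated by finitely many of them. If none
    of these had its annihilator inside that of u, primality would give a scalar killing all of them
    but not u, although u lies in their span. *)
Lemma maximal_elt_finite V : finitely_generated V ->
  exists2 ws : seq V, (forall w, w \in ws -> maximal_elt w) &
    forall u : V, maximal_elt u ->
      exists2 w, w \in ws & forall a, a *: w = 0 <-> a *: u = 0.
Proof.
move=> Vfg; pose S (v : V) :=
  exists2 l : seq V, (forall w, w \in l -> maximal_elt w) & span l v.
have Scat (l k : seq V) : (forall w, w \in l -> maximal_elt w) ->
    (forall w, w \in k -> maximal_elt w) ->
    forall w, w \in l ++ k -> maximal_elt w.
  by move=> lP kP w; rewrite mem_cat => /orP[/lP|/kP].
have HS : subm S.
  split; first by exists [::].
  move=> a u v [l lP lu] [k kP kv]; exists (l ++ k); first exact: Scat.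
  apply: (span_subm _).2.
    by apply: span_sub lu => w wl; rewrite mem_cat wl.
  by apply: span_sub kv => w wl; rewrite mem_cat wl orbT.
have [l lP] := subm_span Rnoeth Vfg HS.
have [ws wsP wsS] : exists2 ws : seq V, (forall w, w \in ws -> maximal_elt w)
    & forall v, span l v -> span ws v.
  have : forall w, w \in l -> S w by move=> w wl; apply/lP/span_mem.
  elim: l {lP} => [|g l IH] lS; first by exists [::].
  have [w wl|ws wsP lws] := IH; first by apply: lS; rewrite inE wl orbT.
  have [k kP kg] := lS g (mem_head _ _).
  exists (k ++ ws); first exact: Scat.
  move=> v [a /lws vag]; rewrite -(subrK (a *: g) v).
  apply: submD; first exact: span_subm.
    by apply: span_sub vag => w wl; rewrite mem_cat wl orbT.
  apply: submZ; first exact: span_subm.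
  by apply: span_sub kg => w wl; rewrite mem_cat wl.
exists ws => // u umax.
have /lP/wsS wsu : S u.
  exists [:: u]; last exact/span_mem/mem_head.
  by move=> w; rewrite inE => /eqP ->.
have [[w wws wu]|nw] :=
    pselect (exists2 w, w \in ws & forall a, a *: w = 0 -> a *: u = 0).
  exists w => // a; split; first exact: wu.
  exact: (wsP w wws).2 umax.1 wu a.
have [|a aws []] := prime_elt_separate umax.1 (maximal_prime_elt umax) (l := ws).
  move=> w wws; apply: contrapT => na; apply: nw; exists w => // a aw.
  by apply: contrapT => au; apply: na; exists a.
apply: (span_min (S := fun u => a *: u = 0) _ aws) wsu.
split; first by rewrite scaler0.
by move=> b x y ax ay; rewrite scalerDr scalerA mulrC -scalerA ax ay scaler0 addr0.
Qed.

(** If the x found so far kills the new w, some b kills the other elements but not w: otherwise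
    maximality would make x kill one of them. Then x + b a works for any a in I that does not kill
    w. *)
Lemma maximal_elt_avoid V (I : R^o -> Prop) (ws : seq V) : subm I ->
  (forall w, w \in ws -> maximal_elt w) ->
  (forall w, w \in ws -> exists2 a : R, I a & a *: w <> 0) ->
  exists2 x : R, I x & forall w, w \in ws -> x *: w <> 0.
Proof.
move=> HI; elim: ws => [|w ws IH] wsP wsI; first by exists 0; [exact: HI.1|].
have [u uws|u uws|x Ix xws] := IH.
- by apply: wsP; rewrite inE uws orbT.
- by apply: wsI; rewrite inE uws orbT.
have wmax := wsP w (mem_head _ _).
have [xw|xw] := pselect (x *: w = 0); last first.
  by exists x => // u; rewrite inE => /orP[/eqP ->|/xws].
have [|b bws bw] := prime_elt_separate wmax.1 (maximal_prime_elt wmax) (l := ws).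
  move=> u uws; apply: contrapT => nb; apply: (xws u uws).
  have umax : maximal_elt u by apply: wsP; rewrite inE uws orbT.
  apply: (umax.2 w wmax.1) => // a au; apply: contrapT => aw.
  by apply: nb; exists a.
have [a Ia aw] := wsI w (mem_head _ _).
exists (x + b * a); first exact: (submD HI Ix (submZ HI b Ia)).
move=> u; rewrite inE scalerDl => /orP[/eqP ->|uws].
  by rewrite xw add0r => /(maximal_prime_elt wmax)[].
by rewrite mulrC -scalerA bws // scaler0 addr0; apply: xws.
Qed.

(** A zero divisor kills a nonzero element, hence a maximal one, hence a member of the finite list
    ws. Either I kills a member of ws, or avoidance finds an x in I killing none, which is then
    regular. *)
Lemma regular_or_prime_elt V (I : R^o -> Prop) :
  finitely_generated V -> subm I ->
  (exists2 x : R, I x & regular_elt x V) \/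
  exists w : V, [/\ w <> 0, prime_elt w & forall a, I a -> (a : R) *: w = 0].
Proof.
move=> Vfg HI; have [ws wsP wsall] := maximal_elt_finite Vfg.
have [[w wws Iw]|nw] :=
    pselect (exists2 w, w \in ws & forall a, I a -> (a : R) *: w = 0).
  right; exists w; split=> //; first exact: (wsP w wws).1.
  exact/maximal_prime_elt/wsP.
have [|x Ix xws] := maximal_elt_avoid HI wsP.
  move=> w wws; apply: contrapT => na; apply: nw; exists w => // a Ia.
  by apply: contrapT => aw; apply: na; exists a.
left; exists x => // v xv; apply: contrapT => /maximal_elt_above[u umax vu].
have [w wws wu] := wsall u umax.
by apply: (xws w wws); apply/wu/vu.
Qed.

End Avoidance.

(** * Nakayama's lemma and depth over a Noetherian local ring *)

Section Local.
Variables (R : comNzRingType) (m : {pred R}).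
Hypotheses (Rnoeth : noetherian R) (Rlocal : local_ring m).
Implicit Types (U V W : lmodType R).

Lemma m_subm : subm (fun a : R^o => (a : R) \in m).
Proof. by case: Rlocal.1.1. Qed.

Lemma m_mull a b : b \in m -> a * b \in m.
Proof. exact: (submZ m_subm). Qed.

(** A non-unit lies in a maximal ideal, obtained from the maximal condition, and m is the only
    one. *)
Lemma notin_m_unit (a : R) : a \notin m -> exists b, b * a = 1.
Proof.
move=> am; apply: contrapT => nb.
pose F (I : R^o -> Prop) := [/\ subm I, I a & ~ I 1].
have [I []//||I [HI Ia I1] Imax] := ideal_max Rnoeth (F := F).
  exists (fun c => exists b : R, c = b * a); split.
  - split; first by exists 0; rewrite mul0r.
    move=> c _ _ [b ->] [d ->]; exists (c * b + d).
    by rewrite mulrDl -mulrA.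
  - by exists 1; rewrite mul1r.
  - by case=> b /esym ba; apply: nb; exists b.
have Imaximal : maximal_ideal (fun c => `[< I c >]).
  split; first split.
  - exact/asboolP/HI.1.
  - by apply/asboolPn.
  - by move=> c u v /asboolP Iu /asboolP Iv; apply/asboolP/HI.2.
  move=> J [J0 J1 JD] IJ c; apply/idP/idP => [Jc|]; last exact: IJ.
  apply/asboolP; apply: (Imax (fun c => c \in J)) => //.
    split=> //; first by apply: IJ; apply/asboolP.
    by move=> J1'; rewrite J1' in J1.
  by move=> b Ib; apply: IJ; apply/asboolP.
by move: am; rewrite -(Rlocal.2 _ Imaximal) => /negP[]; apply/asboolP.
Qed.

Lemma one_sub_m_unit (a : R) : a \in m -> exists b, b * (1 - a) = 1.
Proof.
move=> am; apply: notin_m_unit; apply/negP => am1; case: (Rlocal.1.1) => _ /negP[].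
by rewrite -[1](subrK a); apply: (submD m_subm).
Qed.

(** As 1 - b x is a unit, the first generator lies in the span of the others. Stated for a span
    rather than for V because [depth_chain] applies it to a submodule. *)
Lemma nakayama V (l : seq V) (x : R) : x \in m ->
  (forall v, span l v -> exists2 u, span l u & v = x *: u) ->
  forall v, span l v -> v = 0.
Proof.
move=> xm; elim: l => [|g l IH] lx v //.
have Hl := span_subm l.
have gl : span l g.
  have [u [b ub] gE] := lx g (span_mem (mem_head _ _)).
  have [c cx] := one_sub_m_unit (m_mull b xm).
  have -> : g = c *: (x *: (u - b *: g)).
    rewrite scalerBr -gE scalerA mulrC -{2}[g]scale1r -scalerBl scalerA cx.
    by rewrite scale1r.
  by do 2!apply: submZ => //.
have lE w : span (g :: l) w -> span l w.
  apply: span_min => // u; rewrite inE => /orP[/eqP -> //|]; exact: span_mem.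
move=> /lE; apply: IH => w /(@span_cons _ _ g) /lx[u /lE lu ->].
by exists u.
Qed.

Definition socle_elt V (v : V) : Prop := v <> 0 /\ forall a, a \in m -> a *: v = 0.
Definition has_socle V : Prop := exists v : V, socle_elt v.

Lemma regular_or_socle V : finitely_generated V ->
  (exists2 x, x \in m & regular_elt x V) \/ has_socle V.
Proof.
move=> Vfg; have [|[w [w0 _ mw]]] := regular_or_prime_elt Rnoeth Vfg m_subm.
  by left.
by right; exists w.
Qed.

(** A maximal regular sequence in m, given by its successive quotients and ending with a nonzero
    element killed by m. That n does not depend on the sequence follows from
    [has_depth_quotient]. *)
Fixpoint has_depth (n : nat) V : Prop :=
  if n is n'.+1 then exists (x : R) W (pi : {linear V -> W}),
    [/\ x \in m, regular_elt x V, quotient_map (@multiples _ x V) pi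
      & has_depth n' W]
  else has_socle V.

Lemma has_depth_no_socle n V : has_depth n.+1 V -> ~ has_socle V.
Proof. by case=> x [W [pi [xm xV _ _]]] [v [v0 /(_ x xm) /xV]]. Qed.

Lemma has_depth_nonzero n V : has_depth n V -> ~ zero_module V.
Proof.
elim: n V => [|n IH] V /=; first by case=> v [v0 _] /(_ v).
case=> x [W [pi [_ _ [piS _] /IH W0]]] V0; apply: W0 => w.
by have [v <-] := piS w; rewrite (V0 v) linear0.
Qed.

Lemma quotient_swap V W W' U (x z : R) (pi : {linear V -> W})
    (sg : {linear W -> W'}) (rho : {linear V -> U}) :
  quotient_map (@multiples _ x V) pi -> quotient_map (@multiples _ z W) sg ->
  quotient_map (@multiples _ z V) rho ->
  exists tau : {linear U -> W'}, quotient_map (@multiples _ x U) tau.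
Proof.
move=> [piS piK] [sgS sgK] [rhoS rhoK].
have [|tau tauE] := @quotient_lift _ W' V U _ rho (sg \o pi) (conj rhoS rhoK).
  by move=> _ [u ->] /=; apply/sgK; exists (pi u); rewrite linearZ.
exists tau; split.
  move=> w'; have [w <-] := sgS w'; have [v <-] := piS w.
  by exists (rho v); rewrite tauE.
move=> u; have [v <-] := rhoS u; rewrite tauE /=; split.
  move=> /sgK[w pivE]; have [w' w'E] := piS w.
  have /piK[y yE] : pi (v - z *: w') = 0 by rewrite linearB linearZ w'E pivE subrr.
  exists (rho y); rewrite -linearZ -yE linearB -[LHS]subr0; congr (_ - _).
  by apply/esym/rhoK; exists w'.
move=> [y']; have [y <-] := rhoS y' => rE.
have /rhoK[w wE] : rho (v - x *: y) = 0 by rewrite linearB linearZ rE subrr.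
apply/sgK; exists (pi w); rewrite -linearZ -wE linearB -[LHS]subr0.
by congr (_ - _); apply/esym/piK; exists y.
Qed.

(** The half of the permutability of regular sequences that holds without Nakayama: x v = z w forces
    w = x y, and then v = z y. *)
Lemma regular_swap V W U (x z : R) (pi : {linear V -> W}) (rho : {linear V -> U}) :
  quotient_map (@multiples _ x V) pi -> quotient_map (@multiples _ z V) rho ->
  regular_elt x V -> regular_elt z W -> regular_elt x U.
Proof.
move=> [_ piK] [rhoS rhoK] xV zW u; have [v <-] := rhoS u.
rewrite -linearZ => /rhoK[w wE]; apply/rhoK.
have /piK[y yE] : pi w = 0.
  by apply: zW; rewrite -linearZ -wE; apply/piK; exists v.
exists y; apply/eqP; rewrite -subr_eq0; apply/eqP/xV.
by rewrite scalerBr wE yE !scalerA mulrC subrr.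
Qed.

(** Elementary form of Hom(k, V/x) = Ext^1(k, V) = Hom(k, V/y): if v is a socle element modulo x,
    then y v = x w, and w is a socle element modulo y. *)
Lemma socle_swap V W U (x y : R) (pi : {linear V -> W}) (rho : {linear V -> U}) :
  y \in m -> regular_elt x V -> regular_elt y V ->
  quotient_map (@multiples _ x V) pi -> quotient_map (@multiples _ y V) rho ->
  has_socle W -> has_socle U.
Proof.
move=> ym xV yV [piS piK] [rhoS rhoK] [w [w0 mw]].
have [v vE] := piS w; subst w.
have mv a : a \in m -> exists u, a *: v = x *: u.
  by move=> am; apply/piK; rewrite linearZ /= mw.
have [w wE] := mv y ym.
exists (rho w); split.
  move=> /rhoK[u uE]; apply: w0; apply/piK; exists u; apply/eqP.
  rewrite -subr_eq0; apply/eqP/yV.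
  by rewrite scalerBr wE uE !scalerA mulrC subrr.
move=> a am; rewrite -linearZ; apply/rhoK; have [u uE] := mv a am; exists u.
apply/eqP; rewrite -subr_eq0; apply/eqP/xV.
have xC b c (t : V) : b *: (c *: t) = c *: (b *: t) by rewrite !scalerA mulrC.
by rewrite scalerBr xC -wE (xC x) -uE xC subrr.
Qed.

Lemma has_socle_prod V W : has_socle (V * W)%type -> has_socle V \/ has_socle W.
Proof.
move=> [[v w] [vw0 mvw]].
have mv a : a \in m -> a *: v = 0 by move=> /mvw[].
have mw a : a \in m -> a *: w = 0 by move=> /mvw[].
have [v0|v0] := pselect (v = 0); last by left; exists v.
right; exists w; split => // w0; apply: vw0; by rewrite v0 w0.
Qed.

Lemma regular_prod V W (x : R) : regular_elt x (V * W)%type ->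
  regular_elt x V /\ regular_elt x W.
Proof.
move=> xVW; split=> [v xv|w xw].
  by have [] : (v, 0 : W) = 0 by apply: xVW; congr pair => //; apply: scaler0.
by have [] : (0 : V, w) = 0 by apply: xVW; congr pair => //; apply: scaler0.
Qed.

(** The dichotomy is applied to the product of V and W, a socle element of which has a socle element
    among its components; this gives one element for both modules. *)
Lemma common_regular V W : finitely_generated V -> finitely_generated W ->
  ~ has_socle V -> ~ has_socle W ->
  exists x, [/\ x \in m, regular_elt x V & regular_elt x W].
Proof.
move=> Vfg Wfg sV sW.
have [[x xm /regular_prod[xV xW]]|/has_socle_prod[]//] :=
  regular_or_socle (fg_prod Vfg Wfg).
by exists x.
Qed.

(** Depth drops by one along every regular y, not only along the x that witnesses it. At depth one
    this is [socle_swap]. Above, an auxiliary z regular on V, V/x and V/y links the two: the depth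
    of V/z is obtained through x, lowered through y by induction, and V/(z, y) is then read as a
    quotient of V/y. *)
Lemma has_depth_quotient n V W (y : R) (pi : {linear V -> W}) :
  finitely_generated V -> y \in m -> regular_elt y V ->
  quotient_map (@multiples _ y V) pi -> has_depth n.+1 V -> has_depth n W.
Proof.
elim: n V W y pi => [|n IH] V W2 y pi2 Vfg ym yV q2.
  by case=> x [W1 [pi1 [xm xV q1]]]; apply: socle_swap q1 q2.
move=> DV; case: (DV) => x [W1 [pi1 [xm xV q1 D1]]].
have W1fg := fg_quotient q1 Vfg; have W2fg := fg_quotient q2 Vfg.
have sV := has_depth_no_socle DV; have s1 := has_depth_no_socle D1.
have s2 : ~ has_socle W2 by move=> s2; apply: s1; apply: socle_swap q2 q1 s2.
have [|z [zm zV /regular_prod[zW1 zW2]]] :=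
    common_regular Vfg (fg_prod W1fg W2fg) sV.
  by case/has_socle_prod.
have [W1z [sg1 qs1]] := quotient_ex (multiples_subm z W1).
have [Vz [rho qr]] := quotient_ex (multiples_subm z V).
have D1z := IH _ _ _ _ W1fg zm zW1 qs1 D1.
have Vzfg := fg_quotient qr Vfg.
have DVz : has_depth n.+1 Vz.
  have [tau qt] := quotient_swap q1 qs1 qr.
  by exists x, W1z, tau; split => //; apply: regular_swap q1 qr xV zW1.
have [U [sg2 qs2]] := quotient_ex (multiples_subm y Vz).
have DU := IH _ _ _ _ Vzfg ym (regular_swap q2 qr yV zW2) qs2 DVz.
have [tau qt] := quotient_swap qr qs2 q2.
by exists z, U, tau.
Qed.

Lemma quotient_nonzero V W (x : R) (pi : {linear V -> W}) :
  finitely_generated V -> x \in m -> quotient_map (@multiples _ x V) pi ->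
  ~ zero_module V -> ~ zero_module W.
Proof.
move=> /fg_spanP[l lP] xm [_ piK] V0 W0; apply: V0 => v.
apply: (nakayama xm _ (lP v)) => u _.
by have /piK[w ->] : pi u = 0 by []; exists w.
Qed.

(** Regular sequences terminate: take a counterexample W with largest annihilator. It has a regular
    x in m, and W/x is a counterexample whose annihilator contains ann W and x. By maximality x
    kills W, so W = 0. *)
Lemma has_depth_ex V : finitely_generated V -> ~ zero_module V ->
  exists n, has_depth n V.
Proof.
move=> Vfg V0; apply: contrapT => nD.
pose F (I : R^o -> Prop) := exists W : lmodType R,
  [/\ finitely_generated W, ~ zero_module W, ~ (exists n, has_depth n W)
    & I = (fun a => forall w : W, (a : R) *: w = 0)].
have [||_ [W [Wfg W0 nDW ->]] Wmax] := ideal_max Rnoeth (F := F).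
- move=> _ [W [_ _ _ ->]]; split=> [w|a u v uW vW w].
    exact: (annihilator_subm w).1.
  by apply: (annihilator_subm w).2.
- by exists (fun a => forall v : V, (a : R) *: v = 0), V.
have [[x xm xW]|sW] := regular_or_socle Wfg; last by apply: nDW; exists 0%N.
have [U [pi q]] := quotient_ex (multiples_subm x W).
have Ux (u : U) : x *: u = 0.
  by have [w <-] := q.1 u; rewrite -linearZ; apply/q.2; exists w.
apply: (W0) => w; apply: (xW).
apply: (Wmax (fun a => forall u : U, (a : R) *: u = 0)) => //.
  exists U; split=> //; first exact: fg_quotient q Wfg.
    exact: quotient_nonzero Wfg xm q W0.
  by move=> [n Dn]; apply: nDW; exists n.+1, x, U, pi.
move=> a aW u; have [w' <-] := q.1 u.
by rewrite -linearZ aW linear0.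
Qed.

End Local.

(** * Attained suprema and infima of sets of integers *)

Section ExtendedBounds.
Local Open Scope classical_set_scope.
Implicit Types (A : set (\bar int)) (e : \bar int) (Q : int -> Prop).

Lemma esup_eq A e : A !=set0 -> supremums A e -> esup A = e.
Proof.
move=> [a Aa] Se; rewrite /esup /supremum; case: ifPn => [/eqP A0|_].
  by move: Aa; rewrite A0.
exact: is_subset1_supremums (xgetPex -oo%E (ex_intro _ e Se)) Se.
Qed.

Lemma einf_eq A e : A !=set0 -> infimums A e -> einf A = e.
Proof.
move=> [a Aa] Se; rewrite /einf /infimum; case: ifPn => [/eqP A0|_].
  by move: Aa; rewrite A0.
exact: is_subset1_infimums (xgetPex +oo%E (ex_intro _ e Se)) Se.
Qed.

Lemma esup_max A e : A e -> ubound A e -> esup A = e.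
Proof. by move=> Ae uA; apply: esup_eq; [exists e|split=> // y; apply]. Qed.

Lemma einf_min A e : A e -> lbound A e -> einf A = e.
Proof. by move=> Ae lA; apply: einf_eq; [exists e|split=> // y; apply]. Qed.

Lemma int_max_ex Q (i z : int) : Q i -> (forall j, Q j -> j <= z) ->
  exists2 j, Q j & forall k, Q k -> k <= j.
Proof.
move=> Qi Qz; have exk : exists k : nat, `[< Q (z - k%:Z) >].
  exists `|z - i|%N; apply/asboolP; have := Qz i Qi => iz.
  by have -> : z - (`|z - i|%N)%:Z = i by lia.
case: (ex_minnP exk) => k /asboolP Qk kmin; exists (z - k%:Z) => // j Qj.
have jz := Qz j Qj; rewrite leNgt; apply/negP => kj.
have : (k <= `|z - j|)%N.
  by apply: kmin; apply/asboolP; have -> : z - (`|z - j|%N)%:Z = j by lia.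
by lia.
Qed.

Lemma int_min_ex Q (i z : int) : Q i -> (forall j, Q j -> z <= j) ->
  exists2 j, Q j & forall k, Q k -> j <= k.
Proof.
move=> Qi Qz; have [||j Qj jP] := @int_max_ex (fun j => Q (- j)) (- i) (- z).
- by rewrite opprK.
- by move=> j /Qz; lia.
by exists (- j) => // k Qk; have := jP (- k); rewrite opprK => /(_ Qk); lia.
Qed.

(** Were the set unbounded above, +oo would be its only upper bound, hence its supremum. *)
Lemma esup_int_max Q i : Q i ->
  (esup [set e | exists2 i : int, Q i & e = i%:E] < +oo)%E ->
  exists2 j, Q j & forall k, Q k -> k <= j.
Proof.
move=> Qi; set A := (X in esup X); have A0 : A !=set0 by exists i%:E, i.
have [[z zP] _|nz] := pselect (exists z, forall j, Q j -> j <= z).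
  exact: int_max_ex Qi zP.
rewrite (@esup_eq A +oo%E) ?ltxx//; split=> [e _|[r||] uy]; rewrite ?leey//.
  by case: nz; exists r => j Qj; rewrite -lee_fin; apply: uy; exists j.
by have := uy i%:E (ex_intro2 _ _ i Qi erefl).
Qed.

Lemma einf_int_min Q i : Q i ->
  (-oo < einf [set e | exists2 i : int, Q i & e = i%:E])%E ->
  exists2 j, Q j & forall k, Q k -> j <= k.
Proof.
move=> Qi; set A := (X in einf X); have A0 : A !=set0 by exists i%:E, i.
have [[z zP] _|nz] := pselect (exists z, forall j, Q j -> z <= j).
  exact: int_min_ex Qi zP.
rewrite (@einf_eq A -oo%E) ?ltxx//; split=> [e _|[r||] uy]; rewrite ?leNye//.
  by case: nz; exists r => j Qj; rewrite -lee_fin; apply: uy; exists j.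
by have := uy i%:E (ex_intro2 _ _ i Qi erefl).
Qed.

Lemma esup_int Q i : Q i -> (forall k, Q k -> k <= i) ->
  esup [set e | exists2 i : int, Q i & e = i%:E] = i%:E.
Proof.
move=> Qi iP; apply: esup_max; first by exists i.
by move=> _ [j Qj ->]; rewrite lee_fin; apply: iP.
Qed.

Lemma einf_int Q i : Q i -> (forall k, Q k -> i <= k) ->
  einf [set e | exists2 i : int, Q i & e = i%:E] = i%:E.
Proof.
move=> Qi iP; apply: einf_min; first by exists i.
by move=> _ [j Qj ->]; rewrite lee_fin; apply: iP.
Qed.

End ExtendedBounds.

(** * Regular sequences and the numerical depth *)

Section RegularSequences.
Variables (R : comNzRingType) (m : {pred R}).
Hypotheses (Rnoeth : noetherian R) (Rlocal : local_ring m).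
Implicit Types (U V W : lmodType R) (s : seq R).

Lemma seq_mul_nil V v : @seq_mul R [::] V v <-> v = 0.
Proof.
by split=> [[c ->]|->]; [|exists (fun=> 0)]; rewrite big_ord0.
Qed.

Lemma seq_mul_cons (x : R) s V v :
  seq_mul (x :: s) v <-> exists u : V, seq_mul s (v - x *: u).
Proof.
split=> [[c ->]|[u [c cE]]].
  exists (c ord0), (fun i => c (lift ord0 i)).
  by rewrite big_ord_recl addrAC subrr add0r.
exists (fun i => if unlift ord0 i is Some j then c j else u).
rewrite big_ord_recl unlift_none /= -[v](subrK (x *: u)) cE addrC.
by congr (_ + _); apply: eq_bigr => i _; rewrite liftK.
Qed.

Lemma seq_mul_subm s V : subm (@seq_mul R s V).
Proof.
split=> [|a u v [c ->] [d ->]].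
  by exists (fun=> 0); rewrite big1 // => i _; rewrite scaler0.
exists (fun i => a *: c i + d i); rewrite scaler_sumr -big_split /=.
by apply: eq_bigr => i _; rewrite scalerDr !scalerA mulrC.
Qed.

Lemma seq_mul_mem (x : R) s V (v : V) : x \in s -> seq_mul s (x *: v).
Proof.
elim: s => // y s IH; rewrite inE => /orP[/eqP ->|xs]; apply/seq_mul_cons.
  by exists v; rewrite subrr; apply: (seq_mul_subm s V).1.
by exists 0; rewrite scaler0 subr0; apply: IH.
Qed.

Lemma seq_mul_sub s (I : R^o -> Prop) : subm I -> (forall x, x \in s -> I x) ->
  forall a, @seq_mul R s R^o a -> I a.
Proof.
move=> HI sI a [c ->]; apply: subm_sum => // i.
rewrite -[_ *: _]/(s`_i * c i) mulrC; apply: (submZ HI (c i)).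
exact/sI/mem_nth.
Qed.

Lemma seq_mul_quotient (x : R) s V W (pi : {linear V -> W}) :
  quotient_map (@multiples _ x V) pi ->
  forall v, seq_mul s (pi v) <-> seq_mul (x :: s) v.
Proof.
move=> [piS piK]; elim: s => [|y s IH] v.
  rewrite seq_mul_nil piK seq_mul_cons; split=> [[u ->]|[u /seq_mul_nil e]].
    by exists u; rewrite subrr; apply/seq_mul_nil.
  by exists u; apply/eqP; rewrite -subr_eq0 e.
rewrite seq_mul_cons; split=> [[w]|].
  have [w' <-] := piS w; rewrite -linearZ -linearB => /IH/seq_mul_cons[u H].
  by apply/seq_mul_cons; exists u; apply/seq_mul_cons; exists w'; rewrite addrAC.
move=> /seq_mul_cons[u /seq_mul_cons[w H]]; exists (pi w).
rewrite -linearZ -linearB; apply/IH/seq_mul_cons; exists u.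
by rewrite addrAC.
Qed.

(** Turns the positional definition of a regular sequence into the recursion followed by
    [has_depth]. *)
Lemma regular_seq_cons (x : R) s V W (pi : {linear V -> W}) :
  quotient_map (@multiples _ x V) pi ->
  regular_seq (x :: s) V <-> regular_elt x V /\ regular_seq s W.
Proof.
move=> q; split=> [[rs [v nv]]|[xV [rs [w nw]]]].
  split.
    move=> u xu; apply/(seq_mul_nil u)/(rs 0%N) => //.
    by rewrite /= xu; apply/seq_mul_nil.
  split; last by exists (pi v) => /(seq_mul_quotient _ q).
  move=> i si w; have [u <-] := q.1 w; rewrite -linearZ.
  by move=> /(seq_mul_quotient _ q) /(rs i.+1 si) /(seq_mul_quotient _ q).
have [v vE] := q.1 w; subst w; split.
  move=> [_ u /seq_mul_nil /xV ->|i si u]; first exact/seq_mul_nil.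
  move=> /(seq_mul_quotient _ q); rewrite linearZ => /(rs i si).
  by move=> /(seq_mul_quotient _ q).
by exists v => /(seq_mul_quotient _ q).
Qed.

Lemma regular_seq_nil V : regular_seq [::] V <-> ~ zero_module V.
Proof.
split=> [[_ [v nv]] V0|V0]; first by apply: nv; apply/seq_mul_nil.
split=> //; apply: contrapT => nv; apply: V0 => v; apply: contrapT => v0.
by apply: nv; exists v => /seq_mul_nil.
Qed.

Lemma has_depth_seq n V : has_depth m n V ->
  exists s, [/\ {subset s <= m}, regular_seq s V & size s = n].
Proof.
elim: n V => [|n IH] V.
  by move=> /has_depth_nonzero V0; exists [::]; split=> //; apply/regular_seq_nil.
case=> x [W [pi [xm xV q /IH[s [sm rs <-]]]]]; exists (x :: s); split=> //.
  by move=> y; rewrite inE => /orP[/eqP ->|/sm].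
exact/(regular_seq_cons _ q).
Qed.

Lemma has_depth_bound n V s : finitely_generated V -> has_depth m n V ->
  {subset s <= m} -> regular_seq s V -> (size s <= n)%N.
Proof.
elim: s n V => //= x s IH n V Vfg Dn sm rs.
have [W [pi q]] := quotient_ex (multiples_subm x V).
have [xV rsW] := (regular_seq_cons s q).1 rs.
have xm : x \in m by apply: sm; rewrite mem_head.
case: n Dn => [[v [v0 mv]]|n Dn]; first by case: v0; apply/xV/mv.
apply: (IH n W) => //; first exact: fg_quotient q Vfg.
  exact: has_depth_quotient q Dn.
by move=> y ys; apply: sm; rewrite inE ys orbT.
Qed.

Lemma has_depthP n V : finitely_generated V -> has_depth m n V ->
  depth m V = n%:Z%:E.
Proof.
move=> Vfg Dn; apply: esup_max.
  by have [s [sm rs <-]] := has_depth_seq Dn; exists s.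
move=> _ [s [sm rs ->]]; rewrite lee_fin lez_nat.
exact: has_depth_bound rs.
Qed.

(** The dichotomy of [regular_or_prime_elt] is iterated inside I. Each step lowers the depth, so it
    stops, and then I kills an element with prime annihilator. It will be used for V = R and I = ann
    M, where it yields both the grade and the depth of the quotient. *)
Lemma maximal_regular_seq n V (I : R^o -> Prop) : subm I ->
  (forall a : R^o, I a -> (a : R) \in m) ->
  finitely_generated V -> has_depth m n V ->
  exists s W (pi : {linear V -> W}) (w : W),
    [/\ forall x, x \in s -> I x, regular_seq s V, (size s <= n)%N &
    [/\ quotient_map (@seq_mul R s V) pi, finitely_generated W,
        has_depth m (n - size s) W,
        w <> 0 & prime_elt w /\ forall a, I a -> (a : R) *: w = 0]].
Proof.
move=> HI Im; elim: n V => [|n IH] V Vfg Dn;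
  have [[x Ix xV]|[w [w0 pw Iw]]] := regular_or_prime_elt Rnoeth Vfg HI.
- by case: Dn => v [v0 /(_ x (Im _ Ix))/xV].
- exists [::], V, (idfun : {linear V -> V}), w; split=> //.
    by apply/regular_seq_nil => /(_ w).
  split=> //; split=> [v|v]; first by exists v.
  exact: iff_sym (seq_mul_nil _).
- have xm := Im _ Ix; have [W [pi q]] := quotient_ex (multiples_subm x V).
  have [|s [U [rho [w [sI rs sn [qr Ufg DU w0 pw]]]]]] :=
    IH W (fg_quotient q Vfg); first exact: has_depth_quotient q Dn.
  exists (x :: s), U, (rho \o pi : {linear V -> U}), w; split=> //.
  + by move=> y; rewrite inE => /orP[/eqP ->|/sI].
  + exact/(regular_seq_cons _ q).
  split=> //; split=> [u|v] /=.
    by have [w' <-] := qr.1 u; have [v <-] := q.1 w'; exists v.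
  by rewrite qr.2; apply: seq_mul_quotient q v.
exists [::], V, (idfun : {linear V -> V}), w; split=> //.
  by apply/regular_seq_nil => /(_ w).
split=> //; split=> [v|v]; first by exists v.
exact: iff_sym (seq_mul_nil _).
Qed.

End RegularSequences.

(** * Chains of primes, depth and Krull dimension *)

Section Chains.
Variables (R : comNzRingType) (m : {pred R}).
Hypotheses (Rnoeth : noetherian R) (Rlocal : local_ring m).
Implicit Types (U V W : lmodType R) (s : seq R) (p q : R^o -> Prop).

Definition primeP p : Prop :=
  [/\ subm p, ~ p 1 & forall a b : R, p (a * b) -> p a \/ p b].

(** Indexing by all of [nat], with only the first n + 1 entries constrained, lets chains be extended
    and concatenated by arithmetic on indices. *)
Definition prime_chain (n : nat) (c : nat -> R^o -> Prop) : Prop :=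
  (forall i, (i <= n)%N -> primeP (c i)) /\
  (forall i, (i < n)%N ->
     (forall a, c i a -> c i.+1 a) /\ exists2 a, c i.+1 a & ~ c i a).

Lemma prime_chain_le n c : prime_chain n c -> forall i j, (i <= j <= n)%N ->
  forall a, c i a -> c j a.
Proof.
move=> [_ cS] i j /andP[/subnK <-]; elim: (j - i)%N => // k IH kn a /IH cki.
by apply: (cS _ kn).1; apply: cki; apply: ltnW.
Qed.

Lemma primeP_prime_ideal p : primeP p -> prime_ideal (fun a : R => `[< p a >]).
Proof.
move=> [[p0 pD] p1 pM]; split; first split.
- exact/asboolP.
- by apply/asboolPn.
- by move=> a u v /asboolP pu /asboolP pv; apply/asboolP/pD.
move=> u v /asboolP /pM[pu|pv]; apply/orP; [left|right]; exact/asboolP.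
Qed.

Lemma prime_ideal_primeP (p : {pred R}) : prime_ideal p ->
  primeP (fun a : R^o => (a : R) \in p).
Proof.
move=> [[p0 p1 pD] pM]; split=> //; first exact/negP.
by move=> a b /pM/orP[]; [left|right].
Qed.

(** The condition under the supremum in [dim], isolated so that bounds on [dim] become statements
    about natural numbers. *)
Definition dims V (n : nat) : Prop :=
  exists p : 'I_n.+1 -> {pred R},
      (forall i, prime_ideal (p i) /\ forall a, ann V a -> a \in p i) /\
      forall i j : 'I_n.+1, (i < j)%N ->
        {subset p i <= p j} /\ ~ {subset p j <= p i}.

Lemma chain_dims n c V : prime_chain n c -> (forall a, ann V a -> c 0%N a) ->
  dims V n.
Proof.
move=> Hc annc; exists (fun i a => `[< c (val i) a >]); split.
  move=> i; have i_n : (i <= n)%N by rewrite -ltnS.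
  split; first exact/primeP_prime_ideal/Hc.1.
  by move=> a /annc c0; apply/asboolP/(prime_chain_le Hc _ c0).
move=> i j ij; have j_n : (j <= n)%N by rewrite -ltnS.
split.
  move=> a /asboolP ci; apply/asboolP.
  by apply: (prime_chain_le Hc _ ci); rewrite (ltnW ij).
move=> ji; have i_n := leq_trans ij j_n.
have [_ [a ca nca]] := Hc.2 i i_n; apply: nca.
suff /ji/asboolP : a \in (fun a : R => `[< c (val j) a >]) by [].
by apply/asboolP/(prime_chain_le Hc _ ca); rewrite ij.
Qed.

Lemma dims_chain n V : dims V n ->
  exists2 c, prime_chain n c & forall a, ann V a -> c 0%N a.
Proof.
move=> [p [pP pS]]; exists (fun i a => (a : R) \in p (inord i)).
  split=> [i _|i i_n]; first exact: prime_ideal_primeP (pP _).1.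
  have [|ii ni] := pS (inord i) (inord i.+1).
    by rewrite !inordK ?ltnS // ltnW.
  split=> [a /ii//|]; apply: contrapT => na; apply: ni => a ai.
  by apply: contrapT => nai; apply: na; exists a.
by move=> a; apply: (pP _).2.
Qed.

Lemma dim_max V n : dims V n -> (forall k, dims V k -> (k <= n)%N) ->
  Defs.dim V = n%:Z%:E.
Proof.
move=> Vn Vmax; apply: esup_max; first by exists n.
by move=> _ [k [-> /Vmax kn]]; rewrite lee_fin lez_nat.
Qed.

Lemma dim_bound V n k : Defs.dim V = n%:Z%:E -> dims V k -> (k <= n)%N.
Proof.
move=> dV Vk; pose Q (i : int) := exists2 l : nat, i = l & dims V l.
have dE : Defs.dim V = esup (fun e => exists2 i : int, Q i & e = i%:E).
  congr esup; apply/funext => e; apply/propext.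
  split=> [[l [-> lV]]|[_ [l -> lV] ->]]; first by exists l => //; exists l.
  by exists l.
have Qk : Q k by exists k.
have [|j Qj jmax] := esup_int_max Qk; first by rewrite -[esup _]dE dV ltry.
move: dV; rewrite dE (esup_int Qj jmax) => -[jn].
by have := jmax _ Qk; rewrite jn lez_nat.
Qed.

Lemma chain_cons n c p : prime_chain n c -> primeP p ->
  (forall a, p a -> c 0%N a) -> (exists2 a, c 0%N a & ~ p a) ->
  prime_chain n.+1 (fun i => if i is j.+1 then c j else p).
Proof.
move=> [cP cS] pp pc cp; split=> [[|i]//|[|i]//]; [exact: cP|exact: cS].
Qed.

Lemma chain_rcons n c p : prime_chain n c -> primeP p ->
  (forall a, c n a -> p a) -> (exists2 a, p a & ~ c n a) ->
  prime_chain n.+1 (fun i => if (i <= n)%N then c i else p).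
Proof.
move=> [cP cS] pp cp pc; split=> i i_n; first by case: ifPn => // /cP.
rewrite -ltnS i_n; case: ltnP => [/cS//|n_i].
by have -> : i = n by apply/eqP; rewrite eqn_leq n_i -ltnS i_n.
Qed.

Lemma chain_cat n k b c : prime_chain n b -> prime_chain k c ->
  (forall a, b n a <-> c 0%N a) ->
  prime_chain (n + k) (fun i => if (i <= n)%N then b i else c (i - n)%N).
Proof.
move=> [bP bS] [cP cS] bc; split=> i i_n.
  by case: leqP => [/bP//|n_i]; apply: cP; rewrite leq_subLR.
have [i_lt|] := ltnP i n; first by rewrite (ltnW i_lt); apply: bS.
rewrite leq_eqVlt => /orP[/eqP nE|n_i].
  subst i; rewrite leqnn subSnn; have [|S0 [a ca na]] := cS 0%N.
    by rewrite -(ltn_add2l n) addn0.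
  by split=> [a' /bc/S0//|]; exists a => // /bc.
rewrite leqNgt n_i /= subSn 1?ltnW //.
by apply: cS; rewrite ltn_subLR // ltnW.
Qed.

Lemma annihilator_primeP V (v : V) : v <> 0 -> prime_elt v ->
  primeP (fun a : R^o => (a : R) *: v = 0).
Proof.
by move=> v0 pv; split=> //; [exact: annihilator_subm|rewrite scale1r].
Qed.

Lemma depth_chain n V (w : V) : finitely_generated V -> w <> 0 -> prime_elt w ->
  has_depth m n V ->
  exists2 c, prime_chain n c & forall a, c 0%N a <-> (a : R) *: w = 0.
Proof.
elim: n V w => [|n IH] V w Vfg w0 pw.
  move=> _; exists (fun _ a => (a : R) *: w = 0) => //; split=> // i _.
  exact: annihilator_primeP.
case=> x [W [pi [xm xV q Dn]]].
pose S (u : V) := forall a : R, a *: w = 0 -> a *: u = 0.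
have HS : subm S.
  split=> [a _|b u v Su Sv a aw]; first by rewrite scaler0.
  by rewrite scalerDr scalerA mulrC -scalerA Su // Sv // scaler0 addr0.
have [l lP] := subm_span Rnoeth Vfg HS.
(* If S were inside x V, then S = x S, because x is regular and so an element whose x-multiple is
   killed by p is itself killed by p; Nakayama would then give w = 0. *)
have [u Su nu] : exists2 u, S u & ~ multiples x u.
  apply: contrapT => nu; apply: w0.
  apply: (nakayama Rnoeth Rlocal xm (l := l)); last by apply/lP => a.
  move=> v /lP Sv; apply: contrapT => nv; apply: nu; exists v => // -[u uE].
  apply: nv; exists u => //; apply/lP => a aw; apply: xV.
  by rewrite scalerA mulrC -scalerA -uE; apply: Sv.
have pu0 : pi u <> 0 by move=> /q.2.
have [w' wmax uw'] := maximal_elt_above Rnoeth pu0.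
have [c Hc c0] :=
  IH W w' (fg_quotient q Vfg) wmax.1 (maximal_prime_elt wmax) Dn.
exists (fun i => if i is j.+1 then c j else fun a => (a : R) *: w = 0) => //.
apply: chain_cons => //; first exact: annihilator_primeP.
  by move=> a aw; apply/c0/uw'; rewrite -linearZ Su // linear0.
exists x; last by move=> /xV.
by apply/c0/uw'; rewrite -linearZ; apply/q.2; exists u.
Qed.

(** The prime q is an ideal maximal among those containing J and missing the multiplicative set of
    all x^n b with b outside p. The ideal J misses this set because x is regular modulo J and J is
    inside p. *)
Lemma prime_below (J p : R^o -> Prop) (x : R) : subm J -> primeP p ->
  (forall a, J a -> p a) -> (forall a : R, J (x * a) -> J a) ->
  exists q, [/\ primeP q, forall a, J a -> q a, forall a, q a -> p a & ~ q x].
Proof.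
move=> HJ [Hp p1 pM] Jp Jx.
pose F (I : R^o -> Prop) := [/\ subm I, forall a, J a -> I a
  & forall n (b : R), ~ p b -> ~ I (x ^+ n * b)].
have [I []//||q [Hq Jq qF] qmax] := ideal_max Rnoeth (F := F).
  exists J; split=> // n b pb; elim: n => [|n IH]; first by rewrite mul1r => /Jp.
  by rewrite exprS -mulrA => /Jx.
exists q; split=> //.
- split=> // [q1|a b qab].
    by apply: (qF 0%N 1); rewrite ?mulr1.
  (* For c outside q, the ideal q + (c) meets the multiplicative set. If neither a nor b were in q,
     the product of their two relations would put an element of the set into q. *)
  have key (c : R) : ~ q c ->
      exists n d e y, [/\ ~ p d, q y & x ^+ n * d = y + e * c].
    move=> qc; pose K (z : R^o) := exists e y, q y /\ z = y + e * c.
    apply: contrapT => nK; apply: qc; apply: (qmax K).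
    - split.
      + split; first by exists 0, 0; rewrite mul0r addr0; split=> //; exact: Hq.1.
        move=> r _ _ [e [y [qy ->]]] [e' [y' [qy' ->]]].
        exists (r * e + e'), (r * y + y'); split; first exact: Hq.2.
        by rewrite -[r *: _]/(r * _); ring.
      + by move=> z Jz; exists 0, z; rewrite mul0r addr0; split=> //; apply: Jq.
      by move=> n d pd [e [y [qy zE]]]; apply: nK; exists n, d, e, y.
    + by move=> z qz; exists 0, z; rewrite mul0r addr0.
    by exists 1, 0; rewrite mul1r add0r; split=> //; exact: Hq.1.
  have [qa|/key[n [d [e [y [pd qy E]]]]]] := pselect (q a); first by left.
  have [qb|/key[n' [d' [e' [y' [pd' qy' E']]]]]] := pselect (q b); first by right.
  case: (qF (n + n')%N (d * d')); first by move=> /pM[].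
  have -> : x ^+ (n + n') * (d * d') =
      (y' + e' * b) * y + ((e * a) * y' + (e * e') * (a * b)).
    rewrite exprD mulrACA E E'; ring.
  apply: (submD Hq); first exact: (submZ Hq).
  by apply: (submD Hq); apply: (submZ Hq).
- move=> a qa; apply: contrapT => pa.
  by apply: (qF 0%N a pa); rewrite mul1r.
by move=> qx; apply: (qF 1%N 1) => //; rewrite expr1 mulr1.
Qed.

(** The height of p is at least the length of s. With J generated by all entries but the last one x,
    [prime_below] gives a prime that still contains J and is strictly below p because it misses
    x. *)
Lemma regular_chain s p : primeP p -> (forall x, x \in s -> p x) ->
  regular_seq s (R^o : lmodType R) ->
  exists2 c, prime_chain (size s) c & forall a, c (size s) a <-> p a.
Proof.
move=> pp sp [rs _]; elim/last_ind: s p pp sp rs => [|s x IH] p pp sp rs.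
  by exists (fun=> p).
have HJ := seq_mul_subm s (R^o : lmodType R).
have [||q [qp Jq qp' qx]] := @prime_below (@seq_mul R s R^o) p x HJ pp.
- case: pp => Hp _ _; apply: seq_mul_sub => // y ys.
  by apply: sp; rewrite mem_rcons inE ys orbT.
- move=> a; have := rs (size s); rewrite size_rcons ltnSn => /(_ isT a).
  by rewrite nth_rcons ltnn eqxx -cats1 take_size_cat.
have [||c Hc cq] := IH q qp.
- move=> y ys; apply: Jq; rewrite -[y]mulr1.
  exact: (@seq_mul_mem R y s R^o 1 ys).
- move=> i si v; have := rs i; rewrite size_rcons ltnS (ltnW si) => /(_ isT v).
  by rewrite nth_rcons si -cats1 takel_cat // ltnW.
rewrite size_rcons; exists (fun i => if (i <= size s)%N then c i else p).
  apply: chain_rcons => //; first by move=> a /cq/qp'.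
  exists x; first by apply: sp; rewrite mem_rcons mem_head.
  by move=> /cq.
by move=> a; rewrite ltnn.
Qed.

End Chains.

(** * Homology of complexes and of their quotients *)

Section Complexes.
Variable R : comNzRingType.
Implicit Types (U V W N M : lmodType R) (X Y : complex R).

(** Quantifying over every target degree avoids naming i - 1; by [cycleP] a single j with i = j + 1
    suffices. *)
Definition cycle X i (v : X i) : Prop := forall j, cdiff X i j v = 0.

(* The source degree is only propositionally i + 1, which avoids transporting
   elements along equalities such as i - 1 + 1 = i.                           *)
Definition boundary X i (v : X i) : Prop :=
  exists (j : int) (y : X j), j = i + 1 /\ cdiff X j i y = v.

(** The map h is total but constrained only on cycles, so that W presents the homology without a
    subquotient type. *)
Definition homology_map X i W (h : X i -> W) : Prop :=
  [/\ forall a u v, cycle u -> cycle v -> h (a *: u + v) = a *: h u + h v,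
      forall w, exists2 v, cycle v & h v = w &
      forall v, cycle v -> (h v = 0 <-> boundary v)].

Definition homology_is X i W : Prop := exists h : X i -> W, homology_map h.

Lemma cycle_subm X i : subm (@cycle X i).
Proof.
split=> [j|a u v cu cv j]; first exact: linear0.
by rewrite linearP cu cv scaler0 addr0.
Qed.

Lemma boundary_subm X i : subm (@boundary X i).
Proof.
split=> [|a u v [j [y [ji <-]]] [k [y' [ki <-]]]].
  by exists (i + 1), 0; rewrite linear0.
by subst j k; exists (i + 1), (a *: y + y'); rewrite linearP.
Qed.

Lemma boundary_cycle X i (v : X i) : boundary v -> cycle v.
Proof. by move=> [j [y [_ <-]]] k; apply: cdiffK. Qed.

Lemma boundary_cdiff X i j (y : X j) : boundary (cdiff X j i y).
Proof.
have [ji|ji] := eqVneq j (i + 1); first by exists j, y.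
by rewrite cdiff_shape //; apply: (boundary_subm X i).1.
Qed.

Lemma cycleP X i j (v : X i) : i = j + 1 -> cdiff X i j v = 0 -> cycle v.
Proof.
move=> ij v0 k; have [ik|ik] := eqVneq i (k + 1); last exact: cdiff_shape.
have kj : k = j by lia.
by subst k.
Qed.

Lemma submod_val_linear V (N : submodClosed V) : linear (@submod_val R V N).
Proof. by move=> a u v; rewrite -[LHS]/(val _) linearP. Qed.

Lemma homology_isP X i W : isomorphic (homology X i) W <-> homology_is X i W.
Proof.
pose Z := @cycles R X i; pose B := @boundaries R X i.
have cycE (v : X i) : v \in Z <-> cycle v.
  split=> [|cv]; last by rewrite inE cv.
  by rewrite inE => /eqP; apply: cycleP; rewrite subrK.
have bndE (z : submod Z) : z \in B <-> boundary (val z).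
  split=> [/asboolP[y yz]|[j [y [ji yz]]]]; first by exists (i + 1), y.
  by subst j; apply/asboolP; exists y.
have [|pi piE] := @linear_of_fun _ (submod Z) (homology X i) (quotmod_pi B).
  by move=> a u v; rewrite quotmod_piD -quotmod_piZ.
have q : quotient_map (fun z : submod Z => boundary (val z)) pi.
  split=> [w|z]; first by exists (repr w); rewrite piE; apply: quotmod_reprK.
  by rewrite -bndE -(linear0 pi) !piE quotmod_piP subr0.
split.
  move=> [f [g fK gK]].
  have [h hP] : {h : X i -> W & forall v,
      forall H : v \in Z, h v = f (pi (Submod H))}.
    apply: (@choice _ _ (fun v w => forall H : v \in Z,
      w = f (pi (Submod H)))) => v.
    have [H|nH] := pselect (v \in Z); last by exists 0.
    by exists (f (pi (Submod H))) => H'; rewrite (bool_irrelevance H H').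
  exists h; split.
  - move=> a u v /cycE cu /cycE cv.
    have cuv : a *: u + v \in Z by apply/cycE/(cycle_subm X i).2; apply/cycE.
    rewrite (hP _ cuv) (hP _ cu) (hP _ cv) -!linearP; congr (f (pi _)).
    apply: val_inj; exact: (esym (submod_val_linear a (Submod cu) (Submod cv))).
  - move=> w; have [z zE] := q.1 (g w).
    exists (val z); first by apply/cycE/(valP z).
    rewrite (hP _ (valP z)) -[RHS]gK -zE; congr (f (pi _)); exact: val_inj.
  move=> v /cycE cv; rewrite (hP _ cv) -[X in boundary X]/(val (Submod cv)) -q.2.
  split=> [f0|->]; last exact: linear0.
  by apply: (can_inj fK); rewrite f0 linear0.
move=> [h [hD hS hK]].
have cval (z : submod (Z)) : cycle (val z) by apply/cycE/(valP z).
have [|hv hvE] := @linear_of_fun _ (submod (Z)) W (h \o val).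
  move=> a u v; rewrite /comp -hD; try exact: cval.
  congr h; exact: submod_val_linear.
have [|f fE] := @quotient_lift _ W _ _ _ _ hv q.
  by move=> z bz; rewrite hvE; apply/hK.
exists f; have [] : injective f /\ forall w, exists y, f y = w.
  split=> [x y|w]; last first.
    have [v cv <-] := hS w; have /cycE cv' := cv.
    by exists (pi (Submod cv')); rewrite fE hvE.
  have [z <-] := q.1 x; have [z' <-] := q.1 y => fzz.
  apply/eqP; rewrite -subr_eq0 -linearB; apply/eqP/q.2.
  apply/hK; first exact: cval.
  by rewrite -[LHS]/((h \o val) _) -hvE linearB -!fE fzz subrr.
move=> finj /choice[g gK]; exists g => // x; exact: finj.
Qed.

Lemma zero_homologyP X i :
  zero_module (homology X i) <-> forall v : X i, cycle v -> boundary v.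
Proof.
have [|h [hD hS hK]] := (homology_isP X i (homology X i)).1.
  by exists (idfun : {linear _ -> _}), id.
split=> [H0 v cv|bc w]; first by apply/hK.
by have [v cv <-] := hS w; apply/hK/bc.
Qed.

Lemma homology_zero_module X i : zero_module (X i) -> zero_module (homology X i).
Proof.
move=> X0; apply/zero_homologyP => v _; rewrite (X0 v).
exact: (boundary_subm X i).1.
Qed.

Section QuotientComplex.
Variables (X : complex R) (A : forall i, X i -> Prop).
Arguments A : clear implicits.

Definition quotient_complex_map Y (pi : forall i, {linear X i -> Y i}) : Prop :=
  (forall i, quotient_map (A i) (pi i)) /\
  forall i j v, cdiff Y i j (pi i v) = pi j (cdiff X i j v).

Lemma quotient_complex_ex : (forall i, subm (A i)) ->
  (forall i j v, A i v -> A j (cdiff X i j v)) ->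
  exists Y (pi : forall i, {linear X i -> Y i}), quotient_complex_map pi.
Proof.
move=> HA dA.
pose W i := projT1 (cid (quotient_ex (HA i))).
pose pi i : {linear X i -> W i} := projT1 (cid (projT2 (cid (quotient_ex (HA i))))).
have q i : quotient_map (A i) (pi i) := projT2 (cid (projT2 (cid (quotient_ex (HA i))))).
have dex i j : exists d : {linear W i -> W j},
    forall v, d (pi i v) = pi j (cdiff X i j v).
  apply: (@quotient_lift _ _ _ _ _ _ (pi j \o cdiff X i j) (q i)) => v Av.
  by apply/(q j).2/dA.
pose d i j := projT1 (cid (dex i j)).
have dE i j v : d i j (pi i v) = pi j (cdiff X i j v) := projT2 (cid (dex i j)) v.
have dshape i j : i != j + 1 -> forall x, d i j x = 0.
  by move=> ij x; have [v <-] := (q i).1 x; rewrite dE cdiff_shape // linear0.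
have dd i j k x : d j k (d i j x) = 0.
  by have [v <-] := (q i).1 x; rewrite !dE cdiffK linear0.
by exists (Complex dshape dd), pi.
Qed.

Variables (Y : complex R) (pi : forall i, {linear X i -> Y i}).
Hypothesis HY : quotient_complex_map pi.

Lemma cycle_quotient i (v : X i) : cycle (pi i v) <-> forall j, A j (cdiff X i j v).
Proof.
by split=> cv j; [apply/(HY.1 j).2; rewrite -HY.2|rewrite HY.2; apply/(HY.1 j).2].
Qed.

Lemma boundary_quotient i (v : X i) :
  boundary (pi i v) <-> exists2 v', boundary v' & A i (v - v').
Proof.
split=> [[j [y [ji dy]]]|[_ [j [y [ji <-]]] Av]].
  have [y0 y0E] := (HY.1 j).1 y; subst y; exists (cdiff X j i y0).
    exact: boundary_cdiff.
  by apply/(quotient_map_eq (HY.1 i)); rewrite -dy HY.2.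
by exists j, (pi _ y); split=> //; rewrite HY.2; apply/esym/(quotient_map_eq (HY.1 i)).
Qed.

Lemma homology_quotient i W W' (h : X i -> W) (g : {linear W -> W'}) :
  homology_map h -> (forall w', exists w, g w = w') ->
  (forall v, (forall j, A j (cdiff X i j v)) -> exists2 v', cycle v' & A i (v - v')) ->
  (forall v, cycle v -> A i v -> g (h v) = 0) ->
  (forall v, cycle v -> g (h v) = 0 -> exists2 v', boundary v' & A i (v - v')) ->
  homology_is Y i W'.
Proof.
move=> [hD hS hK] gS lift Ag gb.
have hB u v : cycle u -> cycle v -> h (u - v) = h u - h v.
  by move=> cu cv; rewrite addrC -scaleN1r hD // scaleN1r addrC.
have [h' h'E] : {h' : Y i -> W' & forall q v, cycle v -> pi i v = q -> h' q = g (h v)}.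
  apply: (@choice _ _ (fun q w => forall v, cycle v -> pi i v = q -> w = g (h v))) => q.
  have [[v cv vq]|nv] := pselect (exists2 v, cycle v & pi i v = q); last first.
    by exists 0 => v cv vq; case: nv; exists v.
  exists (g (h v)) => v' cv'; rewrite -vq => /(quotient_map_eq (HY.1 i)) Avv.
  apply/eqP; rewrite eq_sym -subr_eq0 -linearB -hB //; apply/eqP/Ag => //.
  exact: submB (cycle_subm X i) _ _ cv' cv.
have {}lift q : cycle q -> exists2 v, cycle v & pi i v = q.
  have [v <-] := (HY.1 i).1 q => /cycle_quotient/lift[v' cv' Av].
  by exists v' => //; apply/esym/(quotient_map_eq (HY.1 i)).
exists h'; split.
- move=> a _ _ /lift[u cu <-] /lift[v cv <-].
  rewrite (h'E _ u cu erefl) (h'E _ v cv erefl) (h'E _ (a *: u + v)) ?linearP //.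
    by rewrite hD // linearP.
  exact: (cycle_subm X i).2.
- move=> w'; have [w <-] := gS w'; have [v cv <-] := hS w.
  exists (pi i v); last exact: h'E.
  by move=> j; rewrite HY.2 cv linear0.
move=> _ /lift[v cv <-]; rewrite (h'E _ v cv erefl) boundary_quotient.
split=> [/gb|[v' bv' Avv]]; first exact.
have cv' := boundary_cycle bv'; have := Ag (v - v').
rewrite hB // ((hK _ cv').2 bv') subr0; apply=> //.
exact: submB (cycle_subm X i) _ _ cv cv'.
Qed.

End QuotientComplex.

End Complexes.

(** * Reduction of a complex modulo a regular element *)

Section ReductionModuloElement.
Variable R : comNzRingType.
Implicit Types (U V W N M : lmodType R) (X Y : complex R).

(* V is a direct summand of a finite power of N. *)
Definition summand N V : Prop :=
  exists (n : nat) (p : 'I_n -> {linear N -> V}) (q : 'I_n -> {linear V -> N}),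
    forall v, v = \sum_j p j (q j v).

Lemma summand_regular (x : R) N V : summand N V -> regular_elt x N -> regular_elt x V.
Proof.
move=> [n [p [q pq]]] xN v xv; rewrite [v]pq big1 // => j _.
by rewrite (xN (q j v)) ?linear0 // -linearZ xv linear0.
Qed.

Lemma summand_quotient (x : R) N V N' V' (rho : {linear N -> N'})
    (pi : {linear V -> V'}) :
  quotient_map (@multiples _ x N) rho -> quotient_map (@multiples _ x V) pi ->
  summand N V -> summand N' V'.
Proof.
move=> qr qp [n [p [q pq]]].
have [p' p'E] : {p' : 'I_n -> {linear N' -> V'} &
    forall j u, p' j (rho u) = pi (p j u)}.
  apply: (@choice _ _ (fun j (f : {linear N' -> V'}) =>
    forall u, f (rho u) = pi (p j u))) => j.
  apply: (@quotient_lift _ _ _ _ _ _ (pi \o p j) qr) => _ [u ->] /=.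
  by rewrite linearZ; apply/qp.2; exists (p j u).
have [q' q'E] : {q' : 'I_n -> {linear V' -> N'} &
    forall j v, q' j (pi v) = rho (q j v)}.
  apply: (@choice _ _ (fun j (f : {linear V' -> N'}) =>
    forall v, f (pi v) = rho (q j v))) => j.
  apply: (@quotient_lift _ _ _ _ _ _ (rho \o q j) qp) => _ [u ->] /=.
  by rewrite linearZ; apply/qr.2; exists (q j u).
exists n, p', q' => v'; have [v <-] := qp.1 v'.
rewrite {1}[v]pq linear_sum; apply: eq_bigr => j _.
by rewrite q'E p'E.
Qed.

Lemma power_regular (x : R) M n : regular_elt x M ->
  regular_elt x {ffun 'I_n -> M}.
Proof.
move=> xM f /ffunP xf; apply/ffunP => j; rewrite ffunE; apply: xM.
by have := xf j; rewrite !ffunE.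
Qed.

Lemma power_quotient (x : R) M M' n (pi : {linear M -> M'}) :
  quotient_map (@multiples _ x M) pi ->
  exists pin : {linear {ffun 'I_n -> M} -> {ffun 'I_n -> M'}},
    quotient_map (@multiples _ x {ffun 'I_n -> M}) pin.
Proof.
move=> q.
have [|pin pinE] := @linear_of_fun _ {ffun 'I_n -> M} {ffun 'I_n -> M'}
    (fun f => [ffun j => pi (f j)]).
  by move=> a f g; apply/ffunP => j; rewrite !ffunE linearP.
exists pin; split=> [f|f].
  have [g gE] := choice (fun j => q.1 (f j)).
  by exists [ffun j => g j]; rewrite pinE; apply/ffunP => j; rewrite !ffunE gE.
rewrite pinE; split=> [/ffunP f0|[g ->]].
  have [j|g gE] := @choice _ _ (fun j u => f j = x *: u).
    by apply/q.2; have := f0 j; rewrite !ffunE.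
  by exists [ffun j => g j]; apply/ffunP => j; rewrite !ffunE.
by apply/ffunP => j; rewrite !ffunE; apply/q.2; exists (g j).
Qed.

Definition exact_above X (s : int) : Prop :=
  forall i, s < i -> forall v : X i, cycle v -> boundary v.

Definition zero_above X (t : int) : Prop := forall i, t < i -> zero_module (X i).

Variable x : R.

Definition reduction X Y (pi : forall i, {linear X i -> Y i}) : Prop :=
  quotient_complex_map (fun i => @multiples _ x (X i)) pi.

Lemma reduction_ex X : exists Y (pi : forall i, {linear X i -> Y i}), reduction pi.
Proof.
apply: quotient_complex_ex => [i|i j _ [u ->]]; first exact: multiples_subm.
by exists (cdiff X i j u); rewrite linearZ.
Qed.

Variables (X Y : complex R) (pi : forall i, {linear X i -> Y i}).
Hypotheses (HY : reduction pi) (xX : forall i, regular_elt x (X i)).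

Lemma reduction_zero_above t : zero_above X t -> zero_above Y t.
Proof.
move=> X0 i ti q; have [v <-] := (HY.1 i).1 q.
by rewrite (X0 i ti v) linear0.
Qed.

Lemma multiple_cycle i j (v : X i) (w : X j) : cdiff X i j v = x *: w -> cycle w.
Proof. by move=> vw k; apply: (@xX k); rewrite -linearZ -vw cdiffK. Qed.

(** If d v = x w, then w is a cycle whose multiple x w bounds, so w = d y by hypothesis, and v - x y
    is the corrected lift. *)
Lemma reduction_lift i (v : X i) :
  (forall w : X (i - 1), cycle w -> boundary (x *: w) -> boundary w) ->
  (forall j, multiples x (cdiff X i j v)) ->
  exists2 v', cycle v' & multiples x (v - v').
Proof.
move=> Hx /(_ (i - 1))[w vw]; have cw := multiple_cycle vw.
have [|j [y [ji dy]]] := Hx w cw; first by rewrite -vw; apply: boundary_cdiff.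
have ij : j = i by lia.
clear ji; subst j; exists (v - x *: y); last by rewrite subKr; exists y.
have ii : i = i - 1 + 1 by lia.
by apply: (cycleP ii); rewrite linearB linearZ /= dy vw subrr.
Qed.

(** As x is injective on H_(i-1)(X), the long exact sequence leaves H_i(X/x) = H_i(X)/x. *)
Lemma reduction_homology i W W' (rho : {linear W -> W'}) :
  quotient_map (@multiples _ x W) rho ->
  (forall w : X (i - 1), cycle w -> boundary (x *: w) -> boundary w) ->
  homology_is X i W -> homology_is Y i W'.
Proof.
move=> qr Hx [h Hh]; case: (Hh) => hD hS hK.
have hZ u : cycle u -> h (x *: u) = x *: h u.
  move=> cu; rewrite -[x *: u]addr0 hD //; last exact: (cycle_subm X i).1.
  rewrite (hK 0 (cycle_subm X i).1).2 ?addr0 //.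
  exact: (boundary_subm X i).1.
apply: (homology_quotient HY (g := rho) Hh qr.1).
- by move=> v; apply: reduction_lift.
- move=> _ /[swap] [[u ->]] cv; have cu : cycle u.
    by move=> j; apply: (@xX j); rewrite -linearZ cv.
  by apply/qr.2; exists (h u); rewrite hZ.
move=> v cv /qr.2[w hw]; have [u cu uw] := hS w.
exists (v - x *: u); last by rewrite subKr; exists u.
have cxu := submZ (cycle_subm X i) x cu.
apply/hK; first exact: (submB (cycle_subm X i) cv cxu).
rewrite addrC -scaleN1r hD // scaleN1r hZ // uw hw addrC.
exact: subrr.
Qed.

Lemma homology_regular i W : homology_is X i W -> regular_elt x W ->
  forall w : X i, cycle w -> boundary (x *: w) -> boundary w.
Proof.
move=> [h [hD hS hK]] xW w cw bxw; apply/hK => //; apply: xW.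
have c0 : cycle (0 : X i) := (cycle_subm X i).1.
have h0 : h 0 = 0 by apply/hK => //; apply: (boundary_subm X i).1.
rewrite -[RHS]((hK (x *: w) (submZ (cycle_subm X i) x cw)).2 bxw).
by rewrite -[x *: w]addr0 hD // h0 addr0.
Qed.

(** The bound moves to s + 1 because H_(s+1)(X/x) is the part of H_s(X) killed by x. *)
Lemma reduction_exact_above s : exact_above X s -> exact_above Y (s + 1).
Proof.
move=> Xs i si q; have [v <-] := (HY.1 i).1 q => /(cycle_quotient HY) Av.
have [w cw _|v' cv' vv'] := reduction_lift _ Av; first by apply: Xs cw; lia.
by apply/(boundary_quotient HY); exists v' => //; apply: Xs cv'; lia.
Qed.

(* Representatives of the connecting map H_(s+1)(X/x) -> H_s(X). *)
Definition connecting i s (y : X i) (w : X s) : Prop :=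
  i = s + 1 /\ cdiff X i s y = x *: w.

Lemma connecting_ex s (w : X s) : boundary (x *: w) ->
  exists i (y : X i), connecting y w.
Proof. by move=> [i [y [iE dy]]]; exists i, y. Qed.

Lemma connecting_cycle i s (y : X i) (w : X s) : connecting y w -> cycle (pi i y).
Proof.
move=> [iE dy]; apply: (cycleP iE); rewrite HY.2 dy.
by apply/(HY.1 s).2; exists w.
Qed.

Lemma connecting_surj i s (q : Y i) : i = s + 1 -> cycle q ->
  exists (y : X i) (w : X s), [/\ pi i y = q, connecting y w & cycle w].
Proof.
move=> iE; have [y <-] := (HY.1 i).1 q => /(cycle_quotient HY)/(_ s)[w dy].
by exists y, w; split=> //; apply: multiple_cycle dy.
Qed.

(** Injectivity of the connecting map, with a scalar: if a w = d v, then a y - x v is a cycle in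
    degree s + 1, where X is exact. *)
Lemma connecting_mul i s (y : X i) (w : X s) (a : R) : exact_above X s ->
  connecting y w -> boundary (a *: w) -> boundary (a *: pi i y).
Proof.
move=> Xs [iE dy] [j [v [jE dv]]]; have ji : j = i by rewrite iE.
clear jE; subst j; rewrite -linearZ; apply/(boundary_quotient HY).
exists (a *: y - x *: v); last by rewrite subKr; exists v.
apply: Xs; first by lia.
apply: (cycleP iE); rewrite linearB !linearZ /= dy dv scalerN !scalerA.
by rewrite mulrC subrr.
Qed.

(** By contraposition, a nonzero class of H_s(X) comes from a nonzero class of X/x: modulo
    boundaries y = x v, so x w = x (d v), and x is regular on the terms of X. *)
Lemma connecting_boundary i s (y : X i) (w : X s) :
  connecting y w -> boundary (pi i y) -> boundary w.
Proof.
move=> [iE dy] /(boundary_quotient HY)[_ [j [u [jE <-]]] [v yE]].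
have <- : cdiff X i s v = w; last exact: boundary_cdiff.
apply/eqP; rewrite -subr_eq0; apply/eqP/xX.
by rewrite scalerBr -linearZ -yE linearB cdiffK subr0 dy subrr.
Qed.

End ReductionModuloElement.

(** * The Auslander-Buchsbaum type comparison of t - s with depths *)

Section AuslanderBuchsbaum.
Variables (R : comNzRingType) (m : {pred R}).
Implicit Types (U V W N M : lmodType R) (X Y : complex R).

(* f belongs to m Hom(U, V). *)
Definition m_hom U V (f : U -> V) : Prop :=
  forall S : (U -> V) -> Prop, S (fun=> 0) ->
    (forall (a : R) g h, S g -> S h -> S (fun u => a *: g u + h u)) ->
    (forall (a : R) (g : {linear U -> V}), a \in m -> S (fun u => a *: g u)) -> S f.

(** A weak minimality that survives the passage from N to N/x. Values in m X_j would not be enough: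
    it is membership in m Hom(N, X_j) that makes the differential kill the socle of N. *)
Definition top_minimal N X (t : int) : Prop :=
  exists (iota : {linear N -> X t}) (phi : {linear X t -> N}),
    cancel iota phi /\ forall j, m_hom (fun n => cdiff X t j (iota n)).

Lemma m_hom_quotient (x : R) N N' V V' (rho : {linear N -> N'})
    (pi : {linear V -> V'}) (f : N -> V) (f' : N' -> V') :
  quotient_map (@multiples _ x N) rho -> quotient_map (@multiples _ x V) pi ->
  (forall n, f' (rho n) = pi (f n)) -> m_hom f -> m_hom f'.
Proof.
move=> qr qp ff' mf S S0 SD Sm.
have Sext (g h : N' -> V') : (forall n, g (rho n) = h (rho n)) -> S g -> S h.
  move=> gh; suff -> : g = h by [].
  by apply/funext => n'; have [n <-] := qr.1 n'.
have [||a g am|g [gf Sg]] := mf (fun f => exists g,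
    (forall n, g (rho n) = pi (f n)) /\ S g).
- by exists (fun=> 0); split=> // n; rewrite linear0.
- move=> a g h [g' [gE Sg]] [h' [hE Sh]].
  exists (fun n => a *: g' n + h' n); split; last exact: SD.
  by move=> n; rewrite gE hE linearP.
- have [_ [u ->] /=|g' g'E] := @quotient_lift _ _ _ _ _ _ (pi \o g) qr.
    by rewrite linearZ; apply/qp.2; exists (g u).
  exists (fun n => a *: g' n); split; last exact: Sm.
  by move=> n; rewrite g'E linearZ.
by apply: (Sext g) => // n; rewrite gf ff'.
Qed.

Lemma top_minimal_reduction (x : R) N N' X Y t (rho : {linear N -> N'})
    (pi : forall i, {linear X i -> Y i}) :
  quotient_map (@multiples _ x N) rho -> reduction x pi ->
  top_minimal N X t -> top_minimal N' Y t.
Proof.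
move=> qr HY [iota [phi [ik dm]]].
have [_ [u ->] /=|iota' iE] := @quotient_lift _ _ _ _ _ _ (pi t \o iota) qr.
  by rewrite linearZ; apply/(HY.1 t).2; exists (iota u).
have [_ [u ->] /=|phi' pE] := @quotient_lift _ _ _ _ _ _ (rho \o phi) (HY.1 t).
  by rewrite linearZ; apply/qr.2; exists (phi u).
exists iota', phi'; split=> [n'|j].
  by have [n <-] := qr.1 n'; rewrite iE /= pE /= ik.
apply: (m_hom_quotient qr (HY.1 j)) (dm j) => n.
by rewrite iE /= HY.2.
Qed.

Lemma m_hom_socle U V (f : U -> V) (u : U) : m_hom f ->
  (forall a, a \in m -> a *: u = 0) -> f u = 0.
Proof.
move=> mf mu; apply: (mf (fun g => g u = 0)) => // [a g h -> ->|a g am].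
  by rewrite scaler0 addr0.
by rewrite -linearZ mu // linear0.
Qed.

Lemma top_minimal_socle N X t : top_minimal N X t -> zero_above X t ->
  has_socle m N ->
  exists v : X t, [/\ cycle v, ~ boundary v & socle_elt m v].
Proof.
move=> [iota [phi [ik dm]]] Xt [n [n0 mn]]; exists (iota n); split.
- by move=> j; apply: (m_hom_socle (dm j)).
- move=> [j [y [jt dy]]]; apply: n0.
  by rewrite -(ik n) -dy (Xt j _ y) ?linear0 //; lia.
split=> [i0|a am]; first by apply: n0; rewrite -(ik n) i0 linear0.
by rewrite -linearZ mn // linear0.
Qed.

(** The case of a module M of depth 0. Only a nonzero class of H_s killed by m is carried along, as
    the reduced homology need not be a power of a module. Each regular element of N raises s by one
    and keeps t. When N has depth 0, the class gives s <= t, and under minimality the socle of N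
    gives homology in degree t, so t <= s. *)
Lemma socle_homology_top r N X (s t : int) :
  has_depth m r N -> (forall i, summand N (X i)) ->
  exact_above X s -> zero_above X t ->
  (exists z : X s, [/\ cycle z, ~ boundary z
     & forall a, a \in m -> boundary (a *: z)]) ->
  s + r%:Z <= t /\ (top_minimal N X t -> t <= s + r%:Z).
Proof.
elim: r N X s => [|r IH] N X s.
  move=> sN _ Xs Xt [z [cz nz mz]]; rewrite addr0; split.
    rewrite leNgt; apply/negP => /Xt/(_ z) z0.
    by apply: nz; rewrite z0; apply: (boundary_subm X s).1.
  move=> /top_minimal_socle/(_ Xt sN)[v [cv nv _]].
  by rewrite leNgt; apply/negP => /Xs/(_ v cv).
move=> [x [N' [rho [xm xN qr DN']]]] NX Xs Xt [z [cz nz mz]].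
have [Y [pi HY]] := reduction_ex x X.
have xX i := summand_regular (NX i) xN.
have [i [y yz]] := connecting_ex (mz x xm); have [iE _] := yz.
subst i; have [||||st st'] := IH N' Y (s + 1) DN'.
- by move=> i; apply: summand_quotient qr (HY.1 i) (NX i).
- exact: reduction_exact_above HY xX _ Xs.
- exact: reduction_zero_above HY _ Xt.
- exists (pi _ y); split; first exact: connecting_cycle HY _ _ _ _ yz.
    by move=> /(connecting_boundary HY xX yz).
  by move=> a am; apply: connecting_mul HY _ _ _ _ _ Xs yz (mz a am).
split; first by lia.
by move=> /(top_minimal_reduction qr HY)/st'; lia.
Qed.

(** Since x kills the whole of H_s(X), the connecting map identifies H_(s+1)(X/x) with H_s(X). So s
    rises once for each entry of l while t stays. *)
Lemma regular_annihilator_top l N X (s t : int) :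
  regular_seq l N -> (forall i, summand N (X i)) ->
  exact_above X s -> zero_above X t ->
  (exists2 z : X s, cycle z & ~ boundary z) ->
  (forall z : X s, cycle z -> forall a, a \in l -> boundary (a *: z)) ->
  s + (size l)%:Z <= t.
Proof.
elim: l N X s => [|x l IH] N X s.
  move=> _ _ Xs Xt [z cz nz] _; rewrite addr0.
  rewrite leNgt; apply/negP => /Xt/(_ z) z0.
  by apply: nz; rewrite z0; apply: (boundary_subm X s).1.
have [N' [rho qr]] := quotient_ex (multiples_subm x N).
move=> /(regular_seq_cons _ qr)[xN rl] NX Xs Xt [z cz nz] lz.
have [Y [pi HY]] := reduction_ex x X.
have xX i := summand_regular (NX i) xN.
have [i [y yz]] := connecting_ex (lz z cz x (mem_head _ _)); have [iE _] := yz.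
subst i; have := IH N' Y (s + 1) rl _ _ _ _ _; rewrite /=.
move=> st; suff : s + 1 + (size l)%:Z <= t by lia.
apply: st.
- by move=> i; apply: summand_quotient qr (HY.1 i) (NX i).
- exact: reduction_exact_above HY xX _ Xs.
- exact: reduction_zero_above HY _ Xt.
- exists (pi _ y); first exact: connecting_cycle HY _ _ _ _ yz.
  by move=> /(connecting_boundary HY xX yz).
(* Every class of degree s + 1 in Y comes from a class of H_s(X), so the remaining entries of l
   still annihilate it. *)
move=> q /(connecting_surj HY xX erefl)[y' [w [<- yw cw]]] a al.
apply: connecting_mul HY _ _ _ _ _ Xs yw _.
by apply: lz => //; rewrite inE al orbT.
Qed.

Hypotheses (Rnoeth : noetherian R) (Rlocal : local_ring m).

(** Induction on d: an element regular on both N and M replaces each homology module M^(a_i) by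
    (M/x)^(a_i) and lowers r and d together. At d = 0 a socle element of M gives the class required
    by [socle_homology_top]. *)
Lemma auslander_buchsbaum d r N M X (a : int -> nat) (s t : int) :
  finitely_generated N -> finitely_generated M ->
  has_depth m r N -> has_depth m d M -> (forall i, summand N (X i)) ->
  (forall i, homology_is X i {ffun 'I_(a i) -> M}) ->
  a s <> 0%N -> (forall i, s < i -> a i = 0%N) -> zero_above X t ->
  s + r%:Z <= t + d%:Z /\ (top_minimal N X t -> t + d%:Z <= s + r%:Z).
Proof.
move=> + + + + + + as0 a0; elim: d r N M X => [|d IH] r N M X Nfg Mfg DN DM NX HX Xt.
  have Xs : exact_above X s.
    move=> i si v cv; have [h [hD hS hK]] := HX i; apply/hK => //.
    apply/ffunP => j; have := ltn_ord j.
    by rewrite [X in (_ < X)%N]a0.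
  rewrite addr0; apply: socle_homology_top DN NX Xs Xt _.
  case: DM => w [w0 mw]; have [h Hh] := HX s; case: (Hh) => hD hS hK.
  have [z cz zE] := hS [ffun=> w]; exists z; split=> //.
    move=> /hK-/(_ cz); rewrite zE => /ffunP w0'; apply: w0.
    by case: (a s) as0 w0' => // k _ /(_ ord0); rewrite !ffunE.
  move=> b bm; apply/hK; first exact: (submZ (cycle_subm X s) b cz).
  have c0 : cycle (0 : X s) := (cycle_subm X s).1.
  have h0 : h 0 = 0 by apply/hK => //; apply: (boundary_subm X s).1.
  rewrite -[b *: z]addr0 hD // h0 addr0 zE.
  by apply/ffunP => j; rewrite !ffunE mw.
have sM := has_depth_no_socle DM.
(* If N runs out of depth first, the inequality follows from s <= t. Minimality is then impossible:
   the socle of N would give a socle element in H_t, a power of M, whereas M has no socle. *)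
case: r DN => [|r] DN.
  split.
    have st : s <= t.
      rewrite leNgt; apply/negP => /Xt Xs0; have [h [hD hS hK]] := HX s.
      apply: (has_depth_nonzero DM) => w; have [z cz zE] := hS [ffun=> w].
      have h0 : h z = 0 by apply/hK => //; rewrite (Xs0 z); apply: (boundary_subm X s).1.
      move: zE; rewrite h0 => /ffunP.
      by case: (a s) as0 => // k _ /(_ ord0); rewrite !ffunE.
    by lia.
  move=> /top_minimal_socle/(_ Xt DN)[v [cv nv [v0 mv]]].
  have [h [hD hS hK]] := HX t; case: sM.
  have hv0 : h v <> 0 by move=> /hK-/(_ cv).
  have [j hvj] : exists j, h v j <> 0.
    apply: contrapT => nj; apply: hv0; apply/ffunP => j; rewrite ffunE.
    by apply: contrapT => hj; apply: nj; exists j.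
  exists (h v j); split=> // b bm.
  have c0 : cycle (0 : X t) := (cycle_subm X t).1.
  have h0 : h 0 = 0 by apply/hK => //; apply: (boundary_subm X t).1.
  have : h (b *: v + 0) = 0 by rewrite mv // addr0.
  by rewrite hD // h0 addr0 => /ffunP/(_ j); rewrite !ffunE.
have [x [xm xN xM]] := common_regular Rnoeth Rlocal Nfg Mfg (has_depth_no_socle DN) sM.
have [N' [rho qr]] := quotient_ex (multiples_subm x N).
have [M' [sg qs]] := quotient_ex (multiples_subm x M).
have [Y [pi HY]] := reduction_ex x X.
have xX i := summand_regular (NX i) xN.
have [||||||| st st'] := IH r N' M' Y.
- exact: fg_quotient qr Nfg.
- exact: fg_quotient qs Mfg.
- exact: has_depth_quotient qr DN.
- exact: has_depth_quotient qs DM.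
- by move=> i; apply: summand_quotient qr (HY.1 i) (NX i).
- move=> i; have [sgn qsn] := power_quotient (a i) qs.
  apply: reduction_homology HY xX _ _ _ _ qsn _ (HX i).
  exact: homology_regular (HX _) (power_regular xM).
- exact: reduction_zero_above HY _ Xt.
split; first by lia.
by move=> /(top_minimal_reduction qr HY)/st'; lia.
Qed.

End AuslanderBuchsbaum.

(** * Making the top of a resolution minimal *)

Section TopMinimal.
Variables (R : comNzRingType) (m : {pred R}).
Hypotheses (Rnoeth : noetherian R) (Rlocal : local_ring m).
Implicit Types (U V W M P : lmodType R) (X Y : complex R).

Lemma projective_summand P : finitely_generated P -> projective P ->
  summand (R^o : lmodType R) P.
Proof.
move=> [n [g gP]] pP.
have [|f fE] := @linear_of_fun _ {ffun 'I_n -> R^o} P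
    (fun c => \sum_i (c i : R) *: g i).
  move=> a c d; rewrite scaler_sumr -big_split; apply: eq_bigr => i _.
  by rewrite !ffunE /= scalerDl scalerA.
have [v|h hE] := pP {ffun 'I_n -> R^o} P f (idfun : {linear P -> P}).
  have [c ->] := gP v; exists [ffun i => c i]; rewrite fE.
  by apply: eq_bigr => i _; rewrite ffunE.
have [p pE] : {p : 'I_n -> {linear R^o -> P} & forall j a, p j a = a *: g j}.
  apply: (@choice _ _ (fun j (f : {linear R^o -> P}) => forall a, f a = a *: g j)) => j.
  apply: linear_of_fun => a b c; by rewrite scalerDl scalerA.
have [q qE] : {q : 'I_n -> {linear P -> R^o} & forall j v, q j v = h v j}.
  apply: (@choice _ _ (fun j (f : {linear P -> R^o}) => forall v, f v = h v j)) => j.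
  by apply: linear_of_fun => a u v; rewrite linearP !ffunE.
exists n, p, q => v; rewrite -[LHS](hE v) fE.
by apply: eq_bigr => j _; rewrite pE qE.
Qed.

(* v belongs to m V: it lies in every submodule containing all products a u. *)
Definition in_mV V (v : V) : Prop :=
  forall S : V -> Prop, subm S -> (forall (a : R) u, a \in m -> S (a *: u)) -> S v.

Lemma in_mV_subm V : subm (@in_mV V).
Proof.
split=> [S HS _|a u v mu mv S HS Sm]; first exact: HS.1.
by apply: HS.2; [apply: mu|apply: mv].
Qed.

Lemma in_mV_scale V (a : R) (v : V) : a \in m -> in_mV (a *: v).
Proof. by move=> am S _; apply. Qed.

(** Were all coordinates of u in R^n inside m, u would be in m P; so one coordinate is a unit, and
    it can be rescaled to 1. *)
Lemma unimodular P (u : P) : summand (R^o : lmodType R) P -> ~ in_mV u ->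
  exists phi : {linear P -> R^o}, phi u = 1.
Proof.
move=> [n [p [q pq]]] nu.
have [j qj] : exists j, (q j u : R) \notin m.
  apply: contrapT => nj; apply: nu; rewrite [u]pq.
  apply: (subm_sum (in_mV_subm P)) => j.
  have -> : q j u = (q j u : R) *: (1 : R^o) by rewrite -[RHS]/(_ * _) mulr1.
  rewrite linearZ; apply: in_mV_scale; apply: contrapT => /negP qj.
  by apply: nj; exists j.
have [b bq] := notin_m_unit Rnoeth Rlocal qj.
have [|phi phiE] := @linear_of_fun _ P R^o (fun v => b *: q j v).
  by move=> a v w; rewrite linearP scalerDr !scalerA mulrC.
by exists phi; rewrite phiE.
Qed.

(** If u is outside m V, one of its coefficients is a unit and the corresponding generator is
    redundant next to u. The drop in size is the termination measure of [top_minimal_ex]. *)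
Lemma span_exchange V (l : seq V) (u : V) : span l u -> in_mV u \/
  exists l' : seq V, (size l' < size l)%N /\
    forall v, span l v -> span (u :: l') v.
Proof.
elim: l u => [|g l IH] u /=.
  by move=> ->; left; apply: (in_mV_subm V).1.
move=> [c luc]; have [cm|cm] := boolP (c \in m).
  have [mu|[l' [ll' l'P]]] := IH _ luc.
    left; rewrite -(subrK (c *: g) u).
    exact: (submD (in_mV_subm V) mu (in_mV_scale g cm)).
  right; exists (g :: l'); split=> // v [b lvb].
  have HS := span_subm [:: u, g & l'].
  have gS : span [:: u, g & l'] g by apply: span_mem; rewrite !inE eqxx orbT.
  rewrite -(subrK (b *: g) v); apply: (submD HS); last exact: submZ.
  apply: (span_min HS) (l'P _ lvb) => w; rewrite inE => /orP[/eqP ->|wl'].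
    apply: (submB HS); last exact: submZ.
    by apply: span_mem; rewrite mem_head.
  by apply: span_mem; rewrite !inE wl' !orbT.
have [b bc] := notin_m_unit Rnoeth Rlocal cm.
right; exists l; split=> // v [d lvd].
have HS := span_subm (u :: l).
have lS w : span l w -> span (u :: l) w by apply: span_cons.
have gS : span (u :: l) g.
  have -> : g = b *: (u - (u - c *: g)) by rewrite subKr scalerA bc scale1r.
  apply: (submZ HS); apply: (submB HS); last exact: lS.
  by apply: span_mem; rewrite mem_head.
change (span (u :: l) v).
rewrite -(subrK (d *: g) v); apply: (submD HS); first exact: lS.
exact: submZ.
Qed.

Lemma nakayama_in_mV V : finitely_generated V -> (forall v : V, in_mV v) ->
  zero_module V.
Proof.
move=> /fg_spanP[l lP] mV; elim: l lP => [|g l IH] lP; first exact: lP.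
apply: IH => v; have Hl := span_subm l.
(* Modulo the span of l, every element of m V is a multiple of g by an element of m. *)
have [a am lga] : exists2 a, a \in m & span l (g - a *: g).
  apply: (mV g (fun v => exists2 a, a \in m & span l (v - a *: g))).
    split; first by exists 0; [exact: (m_subm Rlocal).1|rewrite scale0r subr0; exact: Hl.1].
    move=> c u w [a am la] [b bm lb]; exists (c * a + b).
      exact: ((m_subm Rlocal).2 c a b am bm).
    suff -> : c *: u + w - (c * a + b) *: g = c *: (u - a *: g) + (w - b *: g).
      exact: Hl.2.
    by rewrite scalerDl scalerBr scalerA opprD addrACA.
  move=> a u am; have [b lub] := lP u; exists (a * b).
    by rewrite mulrC; apply: (m_mull Rlocal).
  by rewrite -scalerA -scalerBr; apply: submZ.
have [b ba] := one_sub_m_unit Rnoeth Rlocal am.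
have lg : span l g.
  rewrite -[g]scale1r -ba -scalerA scalerBl scale1r; exact: submZ.
have [c lvc] := lP v; rewrite -(subrK (c *: g) v).
by apply: submD => //; apply: submZ.
Qed.

(** The map e factors through a section of pi, so W is a retract of P. *)
Lemma projective_retract P W (S : P -> Prop) (pi : {linear P -> W})
    (e : {linear P -> P}) : quotient_map S pi -> (forall v, S v -> e v = 0) ->
  (forall v, pi (e v) = pi v) -> projective P -> projective W.
Proof.
move=> q eS pe pP A B g f gS.
have [sg sgE] := quotient_lift q eS.
have [h hE] := pP A B g (f \o pi) gS.
exists (h \o sg) => w /=; have [v <-] := q.1 w.
by rewrite hE /= sgE pe.
Qed.

(** Extending u by zero lets [cancel_unit] describe its subcomplex by one formula in all degrees. *)
Lemma family_supported_at X t (u : X t) :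
  exists U : forall i, X i, U t = u /\ forall i, i != t -> U i = 0.
Proof.
exists (fun i => if pselect (t = i) is left e then eq_rect t (fun i => X i : Type) u i e
  else 0); split; first by case: pselect => // e; rewrite (Prop_irrelevance e erefl).
by move=> i it; case: pselect => // e; case/eqP: it.
Qed.

(* Dividing by the subcomplex R u -> R (d u), which is contractible as
   [phi (d u) = 1].                                                           *)
Lemma cancel_unit X t t1 (u : X t) (phi : {linear X t1 -> R^o}) :
  t = t1 + 1 -> phi (cdiff X t t1 u) = 1 ->
  exists Y (pi : forall i, {linear X i -> Y i}),
    [/\ forall i, exists S, quotient_map S (pi i),
        forall i W, homology_is X i W -> homology_is Y i W,
        forall i, projective (X i) -> projective (Y i) & pi t u = 0].
Proof.
move=> tE phi1; have [U [Ut U0]] := family_supported_at u.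
(* This is R u in degree t, R (d u) in degree t1, and zero elsewhere, where both [U i] and the
   differential of u vanish. *)
pose A i (v : X i) := exists a b : R, v = a *: U i + b *: cdiff X t i u.
have HA i : subm (@A i).
  split; first by exists 0, 0; rewrite !scale0r addr0.
  move=> c _ _ [a [b ->]] [a' [b' ->]]; exists (c * a + a'), (c * b + b').
  by rewrite scalerDr !scalerA !scalerDl addrACA.
have dA i j v : A i v -> A j (cdiff X i j v).
  move=> [a [b ->]]; have [it|it] := eqVneq i t.
    subst i; exists 0, a; rewrite Ut scale0r add0r linearD !linearZ /=.
    by rewrite cdiffK scaler0 addr0.
  exists 0, 0; rewrite U0 // scaler0 add0r linearZ /= cdiffK scaler0.
  by rewrite !scale0r addr0.
have [Y [pi HY]] := quotient_complex_ex HA dA.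
have dU (a : R) : a *: cdiff X t t1 u = 0 -> a = 0.
  by move=> /(congr1 phi); rewrite linearZ linear0 /= phi1 -[_ *: _]/(_ * _) mulr1.
have t1t : t1 != t by lia.
exists Y, pi; split.
- by move=> i; exists (A i); apply: HY.1.
- move=> i W [h Hh]; case: (Hh) => _ _ hK.
  apply: (homology_quotient HY (g := idfun : {linear W -> W}) Hh).
  + by move=> w; exists w.
  (* Lifting cycles: in degree t, d v = b (d u) is corrected by b u. In other degrees v is already a
     cycle: the only possible obstruction is d v = a u with i - 1 = t, and applying d gives a (d u)
     = 0, so a = 0 by phi. *)
  + move=> v Av; have [it|it] := eqVneq i t.
      subst i; have [a [b vE]] := Av t1; exists (v - b *: u).
        apply: (cycleP tE); rewrite linearB linearZ /= vE U0 // scaler0 add0r.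
        by rewrite ?scalerN subrr.
      by rewrite subKr; exists b, 0; rewrite Ut scale0r addr0.
    exists v; last by rewrite subrr; apply: (HA i).1.
    have [a [b vE]] := Av (i - 1).
    have iE : i = i - 1 + 1 by lia.
    apply: (cycleP iE); rewrite vE (cdiff_shape _ u) ?scaler0 ?addr0; last by lia.
    have [it1|it1] := eqVneq (i - 1) t; last by rewrite U0 // scaler0.
    have : cdiff X (i - 1) t1 (cdiff X i (i - 1) v) = 0 by rewrite cdiffK.
    rewrite vE (cdiff_shape _ u) ?scaler0 ?addr0; last by lia.
    rewrite linearZ /=.
    have -> : cdiff X (i - 1) t1 (U (i - 1)) = cdiff X t t1 u by rewrite it1 Ut.
    by move=> /dU ->; rewrite scale0r.
  + move=> v cv [a [b vE]]; apply/hK => //.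
    have HB := boundary_subm X i.
    have bU : boundary (cdiff X t i u) by apply: boundary_cdiff.
    suff -> : v = b *: cdiff X t i u by apply: (submZ HB).
    rewrite vE; have [it|it] := eqVneq i t; last by rewrite U0 // scaler0 add0r.
    subst i; have := cv t1; rewrite vE Ut linearD !linearZ /= cdiffK scaler0 addr0.
    by move=> /dU ->; rewrite scale0r add0r.
  by move=> v cv /hK bv; exists v; [exact: bv|rewrite subrr; exact: (HA i).1].
- move=> i pXi.
  (* The projections along A are v - phi (d v) u in degree t, v - phi (v) (d u) in degree t1, and
     the identity elsewhere. *)
  suff [e eA pe] : exists2 e : {linear X i -> X i},
      forall v, A i v -> e v = 0 & forall v, pi i (e v) = pi i v.
    exact: projective_retract (HY.1 i) eA pe pXi.
  have [it|it] := eqVneq i t.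
    subst i; have [|e eE] := @linear_of_fun _ (X t) (X t)
        (fun v => v - (phi (cdiff X t t1 v) : R) *: u).
      move=> a v w; rewrite !linearP scalerDl -scalerA scalerBr opprD.
      by rewrite addrACA.
    exists e => [v [a [b ->]]|v].
      rewrite eE (cdiff_shape _ u) ?scaler0 ?addr0; last by lia.
      have pa : phi (cdiff X t t1 (a *: u)) = a.
        by do 2!rewrite linearZ /=; rewrite phi1; apply: mulr1.
      by rewrite Ut pa subrr.
    rewrite eE linearB -[RHS]subr0; congr (_ - _); apply/(HY.1 t).2.
    exists (phi (cdiff X t t1 v)), 0.
    by rewrite Ut scale0r addr0.
  have [it1|it1] := eqVneq i t1.
    subst i; have [|e eE] := @linear_of_fun _ (X t1) (X t1)
        (fun v => v - (phi v : R) *: cdiff X t t1 u).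
      move=> a v w; rewrite !linearP scalerDl -scalerA scalerBr opprD.
      by rewrite addrACA.
    exists e => [v [a [b ->]]|v].
      have pb : phi (b *: cdiff X t t1 u) = b.
        by rewrite linearZ /= phi1; apply: mulr1.
      by rewrite eE U0 // scaler0 add0r pb subrr.
    rewrite eE linearB -[RHS]subr0; congr (_ - _); apply/(HY.1 t1).2.
    by exists 0, (phi v); rewrite scale0r add0r.
  exists (idfun : {linear X i -> X i}) => // v [a [b ->]] /=.
  by rewrite U0 // cdiff_shape ?scaler0 ?addr0 //; lia.
by apply/(HY.1 t).2; exists 1, 0; rewrite Ut scale1r scale0r addr0.
Qed.

(** Here t only bounds the top degree and the exponents cover all degrees, so that cancelling a
    summand changes neither a nor t. *)
Definition bounded_resolution M (a : int -> nat) X (t : int) : Prop :=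
  [/\ forall i, finitely_generated (X i) /\ projective (X i),
      exists b, forall i, i < b -> zero_module (X i),
      zero_above X t &
      forall i, homology_is X i {ffun 'I_(a i) -> M}].

Lemma homology_nonzero M (a : int -> nat) X i : ~ zero_module M ->
  a i <> 0%N -> homology_is X i {ffun 'I_(a i) -> M} -> ~ zero_module (X i).
Proof.
move=> M0 ai0 [h [hD hS hK]] Xi0; apply: M0 => w.
have [v cv vE] := hS [ffun=> w].
have h0 : h v = 0 by apply/hK => //; rewrite (Xi0 v); apply: (boundary_subm X i).1.
move: vE; rewrite h0 => /ffunP.
by case: (a i) ai0 => // k _ /(_ ord0); rewrite !ffunE.
Qed.

(** If some u outside m X_t has d u outside m X_(t-1), cancelling it lowers the number of generators
    of X_t. Otherwise any u outside m X_t, which exists by Nakayama, spans the required copy of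
    R. *)
Lemma top_minimal_step M (a : int -> nat) (t : int) X :
  ~ zero_module (X t) -> bounded_resolution M a X t ->
  top_minimal m (R^o : lmodType R) X t \/
  forall l : seq (X t), (forall v, span l v) ->
  exists Y (l' : seq (Y t)), [/\ bounded_resolution M a Y t,
     forall v, span l' v & (size l' < size l)%N].
Proof.
move=> Xt0 [Xp [b Xb] Xz Xh].
have Xs i : summand (R^o : lmodType R) (X i).
  by apply: projective_summand; case: (Xp i).
have [[u [nu nd]]|nu] := pselect (exists u : X t,
    ~ in_mV u /\ ~ in_mV (cdiff X t (t - 1) u)).
  right=> l lP; have [phi phi1] := unimodular (Xs _) nd.
  have tE : t = t - 1 + 1 by lia.
  have [Y [pi [qpi hY pY pu]]] := cancel_unit tE phi1.
  have [//|[l' [ll' l'P]]] := span_exchange (lP u).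
  exists Y, (map (pi t) l'); split=> //.
  - split.
    + move=> i; split; last by apply: pY; case: (Xp i).
      by have [S q] := qpi i; apply: fg_quotient q _; case: (Xp i).
    + exists b => i ib w; have [S q] := qpi i; have [v <-] := q.1 w.
      by rewrite (Xb i ib v) linear0.
    + move=> i ti w; have [S q] := qpi i; have [v <-] := q.1 w.
      by rewrite (Xz i ti v) linear0.
    by move=> i; apply: hY.
  - move=> w; have [S q] := qpi t; have [v <-] := q.1 w.
    have HS := span_subm (map (pi t) l').
    apply: (@span_min _ _ (u :: l') (fun v => span (map (pi t) l') (pi t v))) (l'P v (lP v)).
      split; first by rewrite linear0; apply: HS.1.
      by move=> c x y; rewrite linearP; apply: HS.2.
    move=> x; rewrite inE => /orP[/eqP ->|xl']; first by rewrite pu; apply: HS.1.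
    exact/span_mem/map_f.
  by rewrite size_map.
left; have [u nmu] : exists u : X t, ~ in_mV u.
  apply: contrapT => nu'; apply: Xt0; apply: nakayama_in_mV.
    by case: (Xp t).
  by move=> v; apply: contrapT => nv; apply: nu'; exists v.
have [phi phi1] := unimodular (Xs t) nmu.
have [|iota iE] := @linear_of_fun _ R^o (X t) (fun c => c *: u).
  by move=> c x y; rewrite scalerDl scalerA.
exists iota, phi; split=> [c|j].
  by rewrite iE linearZ /= phi1 -[LHS]/(c * 1) mulr1.
move=> S S0 SD Sm.
have dE : (fun n => cdiff X t j (iota n)) = fun n : R^o => n *: cdiff X t j u.
  by apply/funext => c; rewrite iE linearZ.
have [tj|tj] := eqVneq t (j + 1); last first.
  suff -> : (fun n => cdiff X t j (iota n)) = fun=> 0 by [].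
  by apply/funext => c; rewrite cdiff_shape.
have jE : j = t - 1 by lia.
subst j; have md : in_mV (cdiff X t (t - 1) u).
  by apply: contrapT => nd; apply: nu; exists u.
rewrite dE; apply: (md (fun v => S (fun n : R^o => (n : R) *: v))).
  split.
    suff -> : (fun n : R^o => (n : R) *: (0 : X (t - 1))) = fun=> 0 by [].
    by apply/funext => n; rewrite scaler0.
  move=> c v w Sv Sw; have := SD c _ _ Sv Sw; congr S; apply/funext => n.
  by rewrite scalerDr !scalerA mulrC.
move=> c v cm; have [|g gE] := @linear_of_fun _ R^o (X (t - 1)) (fun n => n *: v).
  by move=> d x y; rewrite scalerDl scalerA.
have := Sm c g cm; congr S; apply/funext => n.
by rewrite gE !scalerA mulrC.
Qed.

(** Outer induction on the top degree, inner induction on the number of generators of the top term.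
    If that term is zero the degree drops; in degree s this cannot occur, since H_s is a nonzero
    power of M. *)
Lemma top_minimal_ex M (a : int -> nat) (s : int) (k : nat) X :
  ~ zero_module M -> a s <> 0%N -> bounded_resolution M a X (s + k%:Z) ->
  exists k' Y, [/\ (k' <= k)%N, bounded_resolution M a Y (s + k'%:Z)
    & top_minimal m (R^o : lmodType R) Y (s + k'%:Z)].
Proof.
move=> M0 as0; elim: k X => [|k IHk] X HX; have [Xfg _ _ _] := HX.
  have /fg_spanP[l] := (Xfg (s + 0%:Z)).1.
  have [n] := ubnP (size l); elim: n X HX {Xfg} l => // n IHn X HX l ln lP.
  have Xt0 : ~ zero_module (X (s + 0%:Z)).
    case: HX => _ _ _ /(_ s) Hs; have := homology_nonzero M0 as0 Hs.
    by rewrite addr0.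
  have [mX|/(_ l lP)[Y [l' [HY l'P l'l]]]] := top_minimal_step Xt0 HX.
    by exists 0%N, X.
  by apply: (IHn Y HY l') => //; apply: leq_trans l'l _.
have /fg_spanP[l] := (Xfg (s + k.+1%:Z)).1.
have [n] := ubnP (size l); elim: n X HX {Xfg} l => // n IHn X HX l ln lP.
have [Xt0|Xt0] := pselect (zero_module (X (s + k.+1%:Z))).
  have [|k' [Y [k'k HY mY]]] := IHk X.
    case: HX => Xp Xb Xz Xh; split=> // i si.
    have [->//|it] := eqVneq i (s + k.+1%:Z).
    by apply: Xz; lia.
  by exists k', Y; split=> //; apply: leqW.
have [mX|/(_ l lP)[Y [l' [HY l'P l'l]]]] := top_minimal_step Xt0 HX.
  by exists k.+1, X.
by apply: (IHn Y HY l') => //; apply: leq_trans l'l _.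
Qed.

End TopMinimal.

(** * Vanishing of Ext and Rees' theorem *)

Section Ext.
Variable R : comNzRingType.
Implicit Types (U V W N P M : lmodType R) (F X : complex R).

(** Projectivity is applied to the corestriction of g to its image. *)
Lemma projective_lift P U V (f : {linear P -> V}) (g : {linear U -> V}) :
  projective P -> (forall x, exists y, g y = f x) ->
  exists h : {linear P -> U}, forall x, g (h x) = f x.
Proof.
move=> pP fg; pose I v := exists y, g y = v.
have HI : subm I.
  split; first by exists 0; rewrite linear0.
  by move=> a _ _ [u <-] [v <-]; exists (a *: u + v); rewrite linearP.
have gI u : g u \in subm_pred HI by apply/asboolP; exists u.
have fI x : f x \in subm_pred HI by apply/asboolP.
have valI := @val_inj _ _ (submod (subm_pred HI)).
have [|g' g'E] := @linear_of_fun _ U (submod (subm_pred HI)) (fun u => Submod (gI u)).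
  by move=> a u v; apply: valI; rewrite -[RHS]/(submod_val _) submod_val_linear; apply: linearP.
have [|f' f'E] := @linear_of_fun _ P (submod (subm_pred HI)) (fun x => Submod (fI x)).
  by move=> a u v; apply: valI; rewrite -[RHS]/(submod_val _) submod_val_linear; apply: linearP.
have [v|h hE] := pP _ _ g' f'.
  have /asboolP[u uE] := submod_valP v.
  by exists u; apply: valI; rewrite g'E.
exists h => x; have := congr1 (@submod_val _ _ _) (hE x).
by rewrite g'E f'E.
Qed.

Lemma divide_by_regular (x : R) P N (f : {linear P -> N}) :
  regular_elt x N -> (forall v, multiples x (f v)) ->
  exists g : {linear P -> N}, forall v, f v = x *: g v.
Proof.
move=> xN /choice[g0 g0E]; have [|g gE] := @linear_of_fun _ P N g0; last first.
  by exists g => v; rewrite gE.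
move=> a u v; apply/eqP; rewrite -subr_eq0; apply/eqP/xN.
rewrite scalerBr scalerDr -g0E linearP scalerA mulrC -scalerA -!g0E.
exact: subrr.
Qed.

(* H^i(Hom(F, N)) = 0. *)
Definition ext_zero F N (i : int) : Prop :=
  forall f : {linear F i -> N}, (forall j (y : F j), f (cdiff F j i y) = 0) ->
    exists j (g : {linear F j -> N}), i = j + 1 /\ forall v, f v = g (cdiff F i j v).

Lemma ext_zeroP F N (i : int) :
  zero_module (homology (hom_complex F N) (- i)) <-> ext_zero F N i.
Proof.
(* The term of [hom_complex] in degree c is Hom(F (- c), N): with c as the variable, the index - c
   appears literally and i is recovered by [opprK]. *)
suff key c : zero_module (homology (hom_complex F N) c) <-> ext_zero F N (- c).
  by rewrite key opprK.
rewrite zero_homologyP; split=> [H f f0|H f cf].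
  have [|j [g [jE gf]]] := H (f : homM (F (- c)) N).
    by move=> j; apply: homMP => y; apply: f0.
  exists (- j), (g : {linear F (- j) -> N}); split; first by lia.
  by move=> v; rewrite -gf.
have [|j [g [jE gf]]] := H (f : {linear F (- c) -> N}).
  move=> j; rewrite -(opprK j) => y.
  by rewrite -[LHS]/((cdiff (hom_complex F N) c (- j) f : homM _ _) y) cf.
have {}jE : j = - (c + 1) by lia.
subst j; exists (c + 1), (g : homM (F (- (c + 1))) N); split=> //.
by apply: homMP => v; rewrite gf.
Qed.

Section Resolution.
Variables (M : lmodType R) (F : complex R).
Hypothesis HF : projective_resolution F M.

Lemma resolution_zero i : i < 0 -> zero_module (F i).
Proof. by case: HF => H _ _ _; apply: H. Qed.

Lemma resolution_projective i : projective (F i).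
Proof. by case: HF => _ H _ _; apply: H. Qed.

Lemma resolution_exact i (v : F i) : i != 0 -> cycle v -> boundary v.
Proof. by case: HF => _ _ H _ /H/zero_homologyP; apply. Qed.

Lemma resolution_augmentation : exists eps : {linear F 0 -> M},
  (forall w, exists v, eps v = w) /\ forall v, eps v = 0 <-> boundary v.
Proof.
case: HF => _ _ _ /homology_isP[h [hD hS hK]].
have c0 (v : F 0) : cycle v.
  by apply: (@cycleP _ _ _ (-1)) => //; apply: resolution_zero.
have [|eps epsE] := @linear_of_fun _ (F 0) M h; first by move=> a u v; apply: hD.
exists eps; split=> [w|v]; last by rewrite epsE; apply: hK.
by have [v _ <-] := hS w; exists v.
Qed.

(* An element killing M acts on F as a null-homotopic map; sigma is one
   component of the homotopy.                                                 *)
Lemma null_homotopy (x : R) (i i' : int) : (forall w : M, x *: w = 0) ->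
  i' = i + 1 -> exists sigma : {linear F i -> F i'},
    forall v, boundary (x *: v - sigma (cdiff F i' i v)).
Proof.
move=> xM iE.
have neg : i' < 0 -> exists sigma : {linear F i -> F i'},
    forall v, boundary (x *: v - sigma (cdiff F i' i v)).
  move=> i0; exists (\0 : {linear F i -> F i'}) => v.
  rewrite (resolution_zero i0 (_ - _)); exact: (boundary_subm F i').1.
case: i' iE neg => [n|n] iE neg; last exact: neg.
clear neg; elim: n i iE => [|n IH] i iE.
  exists (\0 : {linear F i -> F 0}) => v; rewrite subr0.
  have [eps [_ epsK]] := resolution_augmentation.
  by apply/epsK; rewrite linearZ /= xM.
have iE' : i = n by lia.
subst i; have [|s0 s0P] := IH (n%:Z - 1); first by lia.
(* By the previous component, x - s0 d takes values in boundaries, so it lifts through the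
   differential. The error x v - sg (d v) is then a cycle in positive degree, hence a boundary. *)
have [f fE] : exists f : {linear F n -> F n},
    forall v, f v = x *: v - s0 (cdiff F n (n%:Z - 1) v).
  by exists ((x \*: idfun) \- (s0 \o cdiff F n (n%:Z - 1)) : F n -> F n).
have [|sg sgE] := projective_lift (f := f) (g := cdiff F n.+1 n)
    (@resolution_projective n).
  move=> v; rewrite fE; have [j [y [jE <-]]] := s0P v.
  have {}jE : j = n.+1 by lia.
  by subst j; exists y.
exists sg => v; apply: resolution_exact => //.
apply: (cycleP iE); rewrite linearB linearZ /= sgE fE cdiffK linear0 subr0.
by rewrite ?scalerN subrr.
Qed.

Variables (x : R) (N N' : lmodType R) (rho : {linear N -> N'}).
Hypotheses (xM : forall w : M, x *: w = 0) (xN : regular_elt x N).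
Hypothesis qr : quotient_map (@multiples _ x N) rho.

(** In the long exact sequence of 0 -> N -> N -> N/x -> 0, multiplication by x vanishes on Ext(M, N)
    because x kills M. On cochains, x f = f sg d makes f sg a cocycle modulo x; subtracting a lifted
    coboundary and dividing by x exhibits f as a coboundary. *)
Lemma ext_zero_shift i i' : i' = i + 1 -> ext_zero F N' i -> ext_zero F N i'.
Proof.
move=> iE H f f0; have [sg sgP] := null_homotopy xM iE.
have xf v : x *: f v = f (sg (cdiff F i' i v)).
  apply/eqP; rewrite -subr_eq0 -linearZ -linearB; apply/eqP.
  by have [j [y [_ <-]]] := sgP v.
have [j y /=|j [e [jE eE]]] := H (rho \o (f \o sg)).
  have [ji|ji] := eqVneq j (i + 1); last by rewrite cdiff_shape // !linear0.
  have {}ji : j = i' by lia.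
  by subst j; apply/qr.2; exists (f y); rewrite xf.
have [w|e' e'E] := projective_lift (f := e) (g := rho) (@resolution_projective j).
  exact: qr.1.
have [g gE] : exists g : {linear F i -> N},
    forall v, g v = f (sg v) - e' (cdiff F i j v).
  by exists ((f \o sg) \- (e' \o cdiff F i j) : F i -> N).
have [v|u uE] := divide_by_regular (f := g) xN.
  by apply/qr.2; rewrite gE linearB e'E -eE subrr.
exists i, u; split=> // v; apply/eqP; rewrite -subr_eq0; apply/eqP/xN.
by rewrite scalerBr -uE gE xf cdiffK linear0 subr0 subrr.
Qed.

(** Exactness of Ext^i(M, N) -> Ext^i(M, N/x) -> Ext^(i+1)(M, N). *)
Lemma ext_zero_quotient i i' : i' = i + 1 ->
  ext_zero F N i -> ext_zero F N i' -> ext_zero F N' i.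
Proof.
move=> iE H H' e e0.
have [v|e' e'E] := projective_lift (f := e) (g := rho) (@resolution_projective i).
  exact: qr.1.
have [v /=|f fE] := divide_by_regular (f := e' \o cdiff F i' i) xN.
  by apply/qr.2; rewrite e'E.
have [j y|j [u [jE uE]]] := H' f.
  by apply: xN; rewrite -fE /= cdiffK linear0.
have {}jE : j = i by lia.
subst j; have [g gE] : exists g : {linear F i -> N}, forall v, g v = e' v - x *: u v.
  by exists (e' \- (x \*: u) : F i -> N).
have [j y|j [w [jE wE]]] := H g.
  have [ji|ji] := eqVneq j (i + 1); last by rewrite cdiff_shape // linear0.
  have {}ji : j = i' by lia.
  by subst j; rewrite gE -uE -fE subrr.
exists j, (rho \o w : {linear F j -> N'}); split=> // v /=.
rewrite -wE gE linearB e'E -[LHS]subr0; congr (_ - _).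
by apply/esym/qr.2; exists (u v).
Qed.

End Resolution.

(** Rees' argument: the two previous lemmas trade Ext^(i+1)(M, N) for Ext^i(M, N/x) until l is
    empty. There phi lifts to a nonzero map on F_0, which is no coboundary because F_(-1) = 0.
    Nonvanishing is transported by contraposition and uses the vanishing in lower degrees, hence the
    joint induction. *)
Lemma ext_regular M F (l : seq R) N W (pi : {linear N -> W}) (phi : {linear M -> W}) :
  projective_resolution F M -> quotient_map (@seq_mul R l N) pi ->
  regular_seq l N -> (forall x, x \in l -> forall w : M, x *: w = 0) ->
  (exists w, phi w <> 0) ->
  (forall i : int, i < (size l)%:Z -> ext_zero F N i) /\ ~ ext_zero F N (size l)%:Z.
Proof.
move=> HF + + + [w phi0]; elim: l N pi => [|x l IH] N pi q rl lM.
  split=> [i i0 f f0|H].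
    exists (i - 1), (\0 : {linear F (i - 1) -> N}); split; first by lia.
    by move=> v; rewrite (resolution_zero HF i0 v) linear0.
  have [eps [epsS epsK]] := resolution_augmentation HF.
  have [v|f fE] := projective_lift (f := phi \o eps) (g := pi)
      (resolution_projective HF (i := 0)); first exact: q.1.
  have [j y|j [g [jE gE]]] := H f.
    apply/seq_mul_nil/q.2; rewrite fE /=.
    by rewrite (epsK _).2 ?linear0 //; apply: boundary_cdiff.
  apply: phi0; have [v <-] := epsS w.
  have j0 : j < 0 by move: jE => /=; lia.
  rewrite -[LHS](fE v) gE (resolution_zero HF j0 (cdiff _ _ _ _)).
  by rewrite !linear0.
have [N' [rho qr]] := quotient_ex (multiples_subm x N).
have [xN rl'] := (regular_seq_cons l qr).1 rl.
have [v xv|pi' pi'E] := @quotient_lift _ _ _ _ _ _ pi qr.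
  case: xv => u ->; apply/q.2/seq_mul_cons; exists u; rewrite subrr.
  exact: (seq_mul_subm l N).1.
have q' : quotient_map (@seq_mul R l N') pi'.
  split=> [y|n']; first by have [v <-] := q.1 y; exists (rho v).
  have [v <-] := qr.1 n'; rewrite pi'E q.2.
  exact: iff_sym (seq_mul_quotient l qr v).
have xM := lM x (mem_head _ _).
have [|Hz Hn] := IH N' pi' q' rl'; first by move=> y yl; apply: lM; rewrite inE yl orbT.
have Hz' (i : int) : i < (size (x :: l))%:Z -> ext_zero F N i.
  move=> il; apply: (ext_zero_shift HF xM xN qr (i := i - 1)); first by lia.
  by apply: Hz; move: il => /=; lia.
split=> // H; apply: Hn.
apply: (ext_zero_quotient HF xN qr (i' := (size (x :: l))%:Z)) => //=; first by lia.
by apply: Hz' => /=; lia.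
Qed.

(** Classically, p = ann w lies in the support of M, whence a nonzero map M -> R/p. Induction on the
    generators of M takes the place of localisation at p. *)
Lemma hom_to_prime_elt M W (w : W) :
  finitely_generated M -> w <> 0 -> prime_elt w ->
  (forall a : R, (forall u : M, a *: u = 0) -> a *: w = 0) ->
  exists phi : {linear M -> W}, exists u, phi u <> 0.
Proof.
move=> /fg_spanP[l lP] w0 pw annw.
(* Linearity is asked only on the span, so that generators can be removed; values in R w make
   primality applicable in the inductive step. *)
suff [phi [phiD _ [u _ phiu]]] : exists phi : M -> W,
    [/\ forall a u v, span l u -> span l v -> phi (a *: u + v) = a *: phi u + phi v,
        forall u, span l u -> exists b, phi u = b *: w
      & exists2 u, span l u & phi u <> 0].
  have [a x y|f fE] := @linear_of_fun _ M W phi; first exact: phiD.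
  by exists f, u; rewrite fE.
have {lP} : forall a, (forall u, span l u -> a *: u = 0) -> a *: w = 0.
  by move=> a al; apply: annw => u; apply: al.
elim: l {annw} => [|g l IH] annw.
  by case: w0; rewrite -[w]scale1r; apply: annw => u ->; rewrite scaler0.
have Hl := span_subm l.
(* If all relations of g modulo the span of l kill w, sending g to w and that span to 0 is well
   defined. *)
have [Jw|nJw] := pselect (forall a, span l (a *: g) -> a *: w = 0).
  have [phi phiE] : {phi : M -> W & forall v b, span l (v - b *: g) -> phi v = b *: w}.
    apply: (@choice _ _ (fun v y => forall b, span l (v - b *: g) -> y = b *: w)) => v.
    have [[b lb]|nb] := pselect (exists b, span l (v - b *: g)); last first.
      by exists 0 => b lb; case: nb; exists b.
    exists (b *: w) => c lc; apply/eqP; rewrite -subr_eq0 -scalerBl; apply/eqP/Jw.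
    have -> : (b - c) *: g = (v - c *: g) - (v - b *: g).
      by rewrite opprB [RHS]addrC addrA subrK scalerBl.
    exact: submB.
  exists phi; split.
  - move=> a u v [b lb] [c lc]; rewrite (phiE u b) // (phiE v c) // scalerA -scalerDl.
    apply: phiE.
    have -> : a *: u + v - (a * b + c) *: g = a *: (u - b *: g) + (v - c *: g).
      by rewrite scalerDl scalerBr scalerA opprD addrACA.
    exact: Hl.2.
  - by move=> u [b lb]; exists b; apply: phiE.
  exists g; first exact/span_mem/mem_head.
  by rewrite (phiE g 1) scale1r // subrr; apply: Hl.1.
(* Otherwise multiplication by a moves everything into the span of l. Composed with the map given by
   induction it stays nonzero, as a is outside the prime ann w. *)
have [a lag aw] : exists2 a, span l (a *: g) & a *: w <> 0.
  apply: contrapT => na; apply: nJw => a lag; apply: contrapT => aw.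
  by apply: na; exists a.
have la v : span (g :: l) v -> span l (a *: v).
  move=> [b lb]; rewrite -(subrK (b *: g) v) scalerDr.
  apply: (submD Hl); first exact: submZ.
  by rewrite scalerA mulrC -scalerA; apply: submZ.
have [b bl|phi [phiD phiw [u lu phiu]]] := IH.
  have [|//|//] := pw b a; apply: annw => v /la lv.
  by rewrite -scalerA bl.
have phi0 : phi 0 = 0.
  have := phiD 1 0 0 Hl.1 Hl.1; rewrite !scale1r addr0 => /eqP.
  by rewrite -subr_eq0 opprD addrA subrr add0r oppr_eq0 => /eqP.
exists (fun v => phi (a *: v)); split.
- move=> b x y lx ly; rewrite -phiD; try exact: la.
  by rewrite scalerDr !scalerA mulrC.
- by move=> v lv; apply: phiw; apply: la.
exists u; first exact: span_cons.
have [b bE] := phiw u lu.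
rewrite -[a *: u]addr0 phiD //; last exact: Hl.1.
rewrite phi0 addr0 bE scalerA => /pw[//|bw].
by apply: phiu; rewrite bE.
Qed.

End Ext.

(** * Existence of free resolutions *)

Section FreeResolution.
Variable R : comNzRingType.
Hypothesis Rnoeth : noetherian R.
Implicit Types (M W : lmodType R).

Lemma fg_row k : finitely_generated ('rV[R]_k : lmodType R).
Proof. by exists k, (fun i => delta_mx 0 i) => v; exists (v 0); apply: row_sum_delta. Qed.

Lemma projective_row k : projective ('rV[R]_k : lmodType R).
Proof.
move=> A B g f /(_ (f (delta_mx 0 _))) gS.
have [y yE] : {y : 'I_k -> A & forall i, g (y i) = f (delta_mx 0 i)}.
  exact: (@choice _ _ (fun i a => g a = f (delta_mx 0 i))).
have [|h hE] := @linear_of_fun R 'rV[R]_k A (fun v => \sum_i v 0 i *: y i).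
  move=> a u v; rewrite scaler_sumr -big_split; apply: eq_bigr => i _.
  by rewrite !mxE scalerDl scalerA.
exists h => v; rewrite hE linear_sum {2}[v]row_sum_delta linear_sum.
by apply: eq_bigr => i _; rewrite !linearZ /= yE.
Qed.

(* Entries indexed by all natural numbers, so that the matrices of a resolution
   form a non-dependent sequence.                                              *)
Definition nat_mx (k k' : nat) (e : nat -> nat -> R) : 'M[R]_(k, k') :=
  \matrix_(p < k, q < k') e p q.

Lemma nat_mx_ex k k' (A : 'M[R]_(k, k')) : exists e, A = nat_mx k k' e.
Proof.
exists (fun p q => if (insub p, insub q) is (Some i, Some j) then A i j else 0).
by apply/matrixP => i j; rewrite mxE !valK.
Qed.

Lemma subm_row_space k (S : 'rV[R]_k -> Prop) : subm S ->
  exists k' e, forall v, S v <-> exists u, v = u *m nat_mx k' k e.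
Proof.
move=> HS; have [l lP] := subm_span Rnoeth (fg_row k) HS.
have [e eE] := nat_mx_ex (\matrix_(i < size l) l`_i).
exists (size l), e => v; rewrite lP spanP -eE.
split=> [[c ->]|[u ->]].
  exists (\row_i c i); rewrite mulmx_sum_row.
  by apply: eq_bigr => i _; rewrite mxE rowK.
exists (u 0); rewrite mulmx_sum_row.
by apply: eq_bigr => i _; rewrite rowK.
Qed.

Lemma free_resolution_data M : finitely_generated M ->
  exists (n : nat -> nat) (e : nat -> nat -> nat -> R)
    (eps : {linear 'rV[R]_(n 0%N) -> M}),
  [/\ forall w, exists v, eps v = w,
      forall v, eps v = 0 <-> exists u, v = u *m nat_mx (n 1%N) (n 0%N) (e 0%N) &
      forall a (v : 'rV_(n a.+1)), v *m nat_mx (n a.+1) (n a) (e a) = 0 <->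
        exists u, v = u *m nat_mx (n a.+2) (n a.+1) (e a.+1)].
Proof.
move=> [n0 [g gP]].
have [|eps epsE] := @linear_of_fun R 'rV[R]_n0 M (fun v => \sum_i v 0 i *: g i).
  move=> a u v; rewrite scaler_sumr -big_split; apply: eq_bigr => i _.
  by rewrite !mxE scalerDl scalerA.
have kerS W k (f : {linear 'rV[R]_k -> W}) : subm (fun v => f v = 0).
  split=> [|a u v fu fv]; first exact: linear0.
  by rewrite linearP fu fv scaler0 addr0.
have [n1 [e0 e0P]] := subm_row_space (kerS _ _ eps).
(* The state consists of two ranks and the matrix entries, all of non-dependent type, so the
   successive choices of syzygies become a plain iteration. *)
have [next nextP] : {next : nat * nat * (nat -> nat -> R) -> nat * (nat -> nat -> R) &
    forall st, forall v : 'rV_st.1.1, v *m nat_mx st.1.1 st.1.2 st.2 = 0 <->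
      exists u, v = u *m nat_mx (next st).1 st.1.1 (next st).2}.
  apply: (@choice _ _ (fun (st : nat * nat * (nat -> nat -> R))
    (nx : nat * (nat -> nat -> R)) =>
    forall v : 'rV_st.1.1, v *m nat_mx st.1.1 st.1.2 st.2 = 0 <->
      exists u, v = u *m nat_mx nx.1 st.1.1 nx.2)) => -[[k k'] e] /=.
  have [k2 [e2 e2P]] := subm_row_space (kerS _ _ (mulmxr (nat_mx k k' e))).
  by exists (k2, e2).
pose st a := iter a (fun s => ((next s).1, s.1.1, (next s).2)) (n1, n0, e0).
exists (fun a => (st a).1.2), (fun a => (st a).2), eps; split=> //.
move=> w; have [c ->] := gP w; exists (\row_i c i); rewrite epsE.
by apply: eq_bigr => i _; rewrite mxE.
Qed.

(** [is_Ext] asks for some projective resolution, so one has to be exhibited for the grade to be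
    attained. *)
Lemma projective_resolution_ex M : finitely_generated M ->
  exists F, projective_resolution F M.
Proof.
move=> Mfg; have [n [e [eps [epsS epsK eK]]]] := free_resolution_data Mfg.
pose N (i : int) := if i is Posz a then n a else 0%N.
pose D (i j : int) := nat_mx (N i) (N j)
  (fun p q => if (i, j) is (Posz a, Posz b) then
     if a == b.+1 then e b p q else 0 else 0).
have D0 (i j : int) : (forall b : nat, i = b.+1 -> j = b -> False) -> D i j = 0.
  move=> ij; apply/matrixP => p q; rewrite !mxE.
  case: i j p q ij => [a|a] [b|b] p q ij //=.
  by case: eqP => // ab; case: (ij b) => //; rewrite ab.
have DS a : D a.+1 a = nat_mx (n a.+1) (n a) (e a).
  by apply/matrixP => p q; rewrite !mxE eqxx.
have dshape i j : i != j + 1 ->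
    forall x, (mulmxr (D i j) : {linear 'rV[R]_(N i) -> 'rV[R]_(N j)}) x = 0.
  move=> ij x; rewrite /= D0 ?mulmx0 // => b ib jb.
  by move: ij; rewrite ib jb; lia.
have DD a (v : 'rV_(n a.+2)) : v *m D a.+2 a.+1 *m D a.+1 a = 0.
  by rewrite !DS; apply/eK; exists v.
have dd i j k x : (mulmxr (D j k) : {linear 'rV[R]_(N j) -> 'rV[R]_(N k)})
    ((mulmxr (D i j) : {linear 'rV[R]_(N i) -> 'rV[R]_(N j)}) x) = 0.
  rewrite /=.
  have [[a [ia ja]]|nij] := pselect (exists a : nat, i = a.+1 /\ j = a); last first.
    rewrite (D0 i j) ?mulmx0 ?mul0mx // => b ib jb.
    by apply: nij; exists b.
  have [[b [jb kb]]|njk] := pselect (exists b : nat, j = b.+1 /\ k = b); last first.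
    rewrite (D0 j k) ?mulmx0 // => b jb kb.
    by apply: njk; exists b.
  by subst i j k; case: jb x => -> x; apply: DD.
pose F := @Complex R (fun i => 'rV[R]_(N i) : lmodType R)
  (fun i j => mulmxr (D i j)) dshape dd.
exists F; split.
- by move=> [a|a] // _ v; apply/rowP => -[].
- by move=> i; apply: projective_row.
- move=> [[|a]|a] // _; last first.
    by apply: homology_zero_module => v; apply/rowP => -[].
  apply/zero_homologyP => v /(_ a%:Z) /=; rewrite DS => /eK[u uE].
  by exists a.+2%:Z, u; split=> //=; [lia|rewrite DS -uE].
apply/homology_isP; exists eps; split.
- by move=> a u v _ _; rewrite linearP.
- move=> w; have [v <-] := epsS w; exists v => // j /=.
  by rewrite D0 ?mulmx0.
move=> v _; rewrite epsK; split=> [[u uE]|[j [u [jE uE]]]].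
  by exists 1, u; split=> //=; rewrite DS -uE.
by subst j; exists u; rewrite -uE /= DS.
Qed.

End FreeResolution.

(** * The grade, and integer data of quasi-projective resolutions *)

Section GradeAndResolutions.
Variables (R : comNzRingType) (m : {pred R}).
Hypotheses (Rlocal : local_ring m) (Rnoeth : noetherian R).
Variable M : lmodType R.
Hypotheses (M0 : ~ zero_module M) (Mfg : finitely_generated M).

Lemma isomorphic_zero (V W : lmodType R) : isomorphic V W -> zero_module W ->
  zero_module V.
Proof.
move=> [f [g fK gK]] W0 v; apply: (can_inj fK).
by rewrite (W0 (f v)) (W0 (f 0)).
Qed.

Lemma is_Ext_zeroP i (E : lmodType R) : is_Ext i M (R^o : lmodType R) E ->
  exists2 F, projective_resolution F M &
    (ext_zero F (R^o : lmodType R) i%:Z -> zero_module E).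
Proof.
move=> [F HF iso]; exists F => // /ext_zeroP; exact: isomorphic_zero.
Qed.

(** The element w witnesses that l is maximal in ann M: its annihilator is prime and contains ann M,
    so [hom_to_prime_elt] supplies the nonzero map M -> R/(l) on which Rees' argument rests, for
    every resolution F. *)
Lemma grade_eq (l : seq R) (W : lmodType R) (pi : {linear R^o -> W}) (w : W) :
  quotient_map (@seq_mul R l R^o) pi -> regular_seq l (R^o : lmodType R) ->
  (forall x, x \in l -> ann M x) ->
  w <> 0 -> prime_elt w -> (forall a, ann M a -> a *: w = 0) ->
  grade M = (size l)%:Z%:E.
Proof.
move=> q rl lM w0 pw Mw; have [phi phi0] := hom_to_prime_elt Mfg w0 pw Mw.
have key F (HF : projective_resolution F M) := ext_regular HF q rl lM phi0.
apply: einf_min.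
  have [F HF] := projective_resolution_ex Rnoeth Mfg.
  exists (size l); split=> //.
  exists (homology (hom_complex F (R^o : lmodType R)) (- (size l)%:Z)).
    by exists F => //; exists (idfun : {linear _ -> _}), id.
  by move=> /ext_zeroP; apply: (key F HF).2.
move=> _ [i [[E /is_Ext_zeroP[F HF EF] E0] ->]].
rewrite lee_fin lez_nat leqNgt; apply/negP => il.
by apply/E0/EF/(key F HF).1; rewrite ltz_nat.
Qed.

Lemma ann_in_m a : ann M a -> a \in m.
Proof.
move=> aM; apply: contrapT => /negP/(notin_m_unit Rnoeth Rlocal)[b ba].
by apply: M0 => v; rewrite -[v]scale1r -ba -scalerA aM scaler0.
Qed.

Lemma ann_subm : subm (fun a : R^o => ann M a).
Proof.
split=> [v|a u v uM vM w]; first exact: scale0r.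
exact: (annihilator_subm w).2 (uM w) (vM w).
Qed.

(** s and s + k are the top degrees of the homology and of P; both are attained because P is bounded
    and some exponent is nonzero. *)
Lemma resolution_bounds P : quasi_projective_resolution P M -> bounded P ->
  exists (a : int -> nat) (s : int) (k : nat),
    [/\ a s <> 0%N, forall i, s < i -> a i = 0%N,
        bounded_resolution M a P (s + k%:Z)
      & (csup P - hsup P)%E = k%:Z%:E].
Proof.
move=> [Pb Pp [a [[i0 i0b ai0] aP]]] bP.
pose Q i := ~ zero_module (P i); pose Qh i := ~ zero_module (homology P i).
have QhQ i : Qh i -> Q i by move=> Hi Pi; apply/Hi/homology_zero_module.
have power0 n : n <> 0%N -> ~ zero_module ({ffun 'I_n -> M} : lmodType R).
  move=> n0 V0; apply: M0 => w; have /ffunP := V0 [ffun=> w].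
  by case: n n0 V0 => // k _ _ /(_ ord0); rewrite !ffunE.
have Qhi i : (cinf P <= i%:E)%E -> a i <> 0%N -> Qh i.
  move=> /aP [f [g fK gK]] /power0 V0 H0; apply: V0 => w.
  by rewrite -(gK w) (H0 (g w)) linear0.
have Qi0 := QhQ _ (Qhi _ i0b ai0).
have [b Qb bmin] := einf_int_min Qi0 Pb.
have bE : cinf P = b%:E by apply: einf_int.
have Pfin : (csup P < +oo)%E.
  by move: bP; rewrite /bounded bE; case: (csup P) => [r||] //=; rewrite ?ltry ?ltxx.
have [t Qt tmax] := esup_int_max Qi0 Pfin.
have tE : csup P = t%:E by apply: esup_int.
have [s Qs smax] := int_max_ex (Qhi _ i0b ai0) (fun i Hi => tmax i (QhQ i Hi)).
have sE : hsup P = s%:E by apply: esup_int.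
have st : s <= t by apply/tmax/QhQ.
(* The exponents are prescribed only from inf P upwards; below it P vanishes and the exponent must
   be 0. *)
pose a' i := if b <= i then a i else 0%N.
have Pz i : ~ Q i -> zero_module (P i) by move=> nQ; apply: contrapT.
have Hi i : homology_is P i {ffun 'I_(a' i) -> M}.
  rewrite /a'; case: ifPn => [bi|bi].
    by apply/homology_isP/aP; rewrite bE lee_fin.
  have Pi0 : zero_module (P i) by apply: Pz => Qi; rewrite (bmin i Qi) in bi.
  have V0 : zero_module ({ffun 'I_0 -> M} : lmodType R) by move=> f; apply/ffunP => -[].
  exists (fun=> 0); split=> [c u v _ _|w|v _].
  - by rewrite scaler0 addr0.
  - by exists 0; [exact: (cycle_subm P i).1|rewrite (V0 w)].
  by split=> // _; rewrite (Pi0 v); apply: (boundary_subm P i).1.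
have iso i := (homology_isP P i {ffun 'I_(a' i) -> M}).2 (Hi i).
exists a', s, `|t - s|%N; have tsE : s + `|t - s|%N%:Z = t by lia.
split.
- move=> as0; apply: Qs; apply: isomorphic_zero (iso s) _.
  by rewrite as0 => f; apply/ffunP => -[].
- move=> i si; apply: contrapT => /power0 V0; have Qi : Qh i.
    move=> H0; apply: V0; have [f [g fK gK]] := iso i => w.
    by rewrite -(gK w) (H0 (g w)) linear0.
  by have := smax i Qi; lia.
- rewrite tsE; split=> // [|i ti].
    by exists b => i ib; apply: Pz => /bmin; lia.
  by apply: Pz => /tmax; lia.
rewrite tE sE -EFinB; congr (_%:E); lia.
Qed.

(** Only an inequality is available, since P may vanish in degree s + k. *)
Lemma resolution_of_bounded (a : int -> nat) (s : int) (k : nat) P :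
  a s <> 0%N -> (forall i, s < i -> a i = 0%N) ->
  bounded_resolution M a P (s + k%:Z) ->
  [/\ quasi_projective_resolution P M, bounded P
    & (csup P - hsup P <= k%:Z%:E)%E].
Proof.
move=> as0 a0 [Pp [b Pb] Pz Ph].
have Qs : ~ zero_module (P s) := homology_nonzero M0 as0 (Ph s).
have iso i := (homology_isP P i {ffun 'I_(a i) -> M}).2 (Ph i).
have Pt i : ~ zero_module (P i) -> i <= s + k%:Z.
  by move=> Qi; rewrite leNgt; apply/negP => /Pz.
have Pb' i : ~ zero_module (P i) -> b <= i.
  by move=> Qi; rewrite leNgt; apply/negP => /Pb.
have [t Qt tmax] := int_max_ex Qs Pt; have [c Qc cmin] := int_min_ex Qs Pb'.
have tE : csup P = t%:E by apply: esup_int.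
have cE : cinf P = c%:E by apply: einf_int.
have Hs : ~ zero_module (homology P s).
  move=> H0; apply: M0 => w; have [f [g fK gK]] := iso s.
  have := gK [ffun=> w]; rewrite (H0 (g _)) linear0 => /ffunP.
  by case: (a s) as0 => // n _ /(_ ord0); rewrite !ffunE.
have sE : hsup P = s%:E.
  apply: esup_int => // i Hi; rewrite leNgt; apply/negP => si; apply: Hi.
  apply: isomorphic_zero (iso i) _.
  by rewrite (a0 i si) => f; apply/ffunP => -[].
split.
- split=> //; first by rewrite /bounded_below cE ltNyr.
  exists a; split; last by move=> i _; apply: iso.
  by exists s => //; rewrite cE lee_fin; apply: cmin.
- by rewrite /bounded tE cE -EFinB ltry.
by rewrite tE sE -EFinB lee_fin; have := Pt t Qt; lia.
Qed.

End GradeAndResolutions.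

(** * The numerical bounds and the two implications *)

Lemma bounded_resolution_bounds (R : comNzRingType) (m : {pred R})
    (M : lmodType R) (a : int -> nat) (s : int) (k r d : nat) (l : seq R)
    (P : complex R) :
  noetherian R -> local_ring m -> finitely_generated M ->
  a s <> 0%N -> (forall i, s < i -> a i = 0%N) ->
  bounded_resolution M a P (s + k%:Z) ->
  has_depth m r (R^o : lmodType R) -> has_depth m d M ->
  regular_seq l (R^o : lmodType R) -> (forall x, x \in l -> ann M x) ->
  [/\ (size l <= k)%N, (r <= k + d)%N &
    top_minimal m (R^o : lmodType R) P (s + k%:Z) -> (k + d <= r)%N].
Proof.
move=> Rnoeth Rlocal Mfg as0 a0 [Pp _ Pz Ph] Dr Dd rl lM.
have Ps i : summand (R^o : lmodType R) (P i).
  by apply: projective_summand; case: (Pp i).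
have [] := auslander_buchsbaum Rnoeth Rlocal (fg_regular R) Mfg Dr Dd Ps Ph as0 a0 Pz.
move=> rk kr; suff lk : s + (size l)%:Z <= s + k%:Z.
  by split=> [||/kr]; lia.
have M0 := has_depth_nonzero Dd.
have h0 i (h : P i -> {ffun 'I_(a i) -> M}) : homology_map h -> h 0 = 0.
  by move=> [_ _ hK]; apply/hK; [exact: (cycle_subm P i).1|exact: (boundary_subm P i).1].
apply: (regular_annihilator_top rl Ps _ Pz).
- move=> i si v cv; have [h [hD hS hK]] := Ph i; apply/hK => //.
  apply/ffunP => j; have := ltn_ord j.
  by rewrite [X in (_ < X)%N]a0.
- apply: contrapT => nz; apply: M0 => w.
  have [h Hh] := Ph s; case: (Hh) => hD hS hK; have [z cz zE] := hS [ffun=> w].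
  have hz : h z = 0.
    by apply/hK => //; apply: contrapT => bz; apply: nz; exists z.
  move: zE; rewrite hz => /ffunP.
  by case: (a s) as0 => // n _ /(_ ord0); rewrite !ffunE.
move=> z cz x xl; have [h Hh] := Ph s; case: (Hh) => hD hS hK.
apply/hK; first exact: (submZ (cycle_subm P s) x cz).
rewrite -[x *: z]addr0 hD //; last exact: (cycle_subm P s).1.
rewrite h0 // addr0; apply/ffunP => j.
by rewrite !ffunE; apply: (lM x xl).
Qed.

Theorem proposition5p7 (R : comNzRingType) (m : {pred R})
    (R_local : local_ring m) (R_noetherian : noetherian R)
    (M : lmodType R) (M_neq0 : ~ zero_module M)
    (M_fg : finitely_generated M) (M_qpd : (qpd M < +oo)%E) :
  (cohen_macaulay m M -> quasi_perfect M) /\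
  (cohen_macaulay m (R^o : lmodType R) -> quasi_perfect M -> cohen_macaulay m M).
Proof.
have R0 : ~ zero_module (R^o : lmodType R).
  by move=> /(_ (1 : R)) /eqP; rewrite oner_eq0.
have Rfg := fg_regular R.
have [r Dr] := has_depth_ex R_noetherian R_local Rfg R0.
have [d Dd] := has_depth_ex R_noetherian R_local M_fg M_neq0.
have [l [W [pi [w [lM rl lr [q Wfg DW w0 [pw Mw]]]]]]] :=
  maximal_regular_seq R_noetherian R_local (ann_subm M)
    (ann_in_m R_local R_noetherian M_neq0) Rfg Dr.
have gradeE := grade_eq R_noetherian M_fg q rl lM w0 pw Mw.
have bounds a s k P as0 a0 HP := bounded_resolution_bounds (a := a) (s := s)
  (k := k) (P := P) R_noetherian R_local M_fg as0 a0 HP Dr Dd rl lM.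
pose A (e : \bar int) := exists P, [/\ quasi_projective_resolution P M, bounded P
                            & e = (csup P - hsup P)%E].
(* The infimum of the empty set is +oo by convention, so finiteness of qpd M provides a bounded
   resolution. *)
have A0 : exists e, A e.
  apply: contrapT => nA; move: M_qpd; rewrite /qpd.
  have -> : (fun e => exists P, [/\ quasi_projective_resolution P M, bounded P
      & e = (csup P - hsup P)%E]) = classical_sets.set0.
    by apply/funext => e; apply/propext; split=> // Ae; apply: nA; exists e.
  by rewrite /einf /classical_sets.infimum eqxx ltxx.
have AP e : A e -> exists k : nat,
    [/\ e = k%:Z%:E, (size l <= k)%N & (r <= k + d)%N].
  move=> [P [HP bP ->]].
  have [a [s [k [as0 a0 Pk kE]]]] := resolution_bounds M_neq0 HP bP.
  by have [lk rk _] := bounds a s k P as0 a0 Pk; exists k.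
have depthM := has_depthP R_noetherian R_local M_fg Dd.
have depthR := has_depthP R_noetherian R_local Rfg Dr.
split=> [cmM|cmR [_ qpdE]].
  have dimM : Defs.dim M = d%:Z%:E by rewrite -cmM depthM.
  (* R/(l) has depth r - g and its associated prime ann w contains ann M, so the chain above ann w
     is counted by dim M = d. *)
  have rd : (r - size l <= d)%N.
    have [c Hc c0] := depth_chain R_noetherian R_local Wfg w0 pw DW.
    by apply: (dim_bound dimM); apply: (chain_dims Hc) => a /Mw/c0.
  split=> //; rewrite gradeE; apply: einf_min.
    (* Once the top is minimal, k' + d <= r, hence k' <= g by the previous bound, while every member
       of A is at least g. *)
    have [_ [P [HP bP _]]] := A0.
    have [a [s [k [as0 a0 Pk _]]]] := resolution_bounds M_neq0 HP bP.
    have [k' [Y [_ HY mY]]] := top_minimal_ex R_noetherian R_local M_neq0 as0 Pk.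
    have [lk _ /(_ mY) kr] := bounds a s k' Y as0 a0 HY.
    have [HQ bY Yk] := resolution_of_bounded M_neq0 as0 a0 HY.
    have AY : A (csup Y - hsup Y)%E by exists Y.
    have [k2 [k2E lk2 _]] := AP _ AY.
    exists Y; split=> //; rewrite k2E; congr (_%:Z%:E).
    by move: Yk; rewrite k2E lee_fin; lia.
  by move=> e /AP[k [-> lk _]]; rewrite lee_fin lez_nat.
have dimR : Defs.dim (R^o : lmodType R) = r%:Z%:E by rewrite -cmR depthR.
(* An infimum of natural numbers is attained, so r <= k + d applies to a resolution with k = qpd M =
   g. *)
have rgd : (r <= size l + d)%N.
  have exk : exists k : nat, `[< A k%:Z%:E >].
    have [e Ae] := A0; have [k [eE _ _]] := AP e Ae.
    by exists k; apply/asboolP; rewrite -eE.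
  case: (ex_minnP exk) => k /asboolP Ak kmin.
  have qk : qpd M = k%:Z%:E.
    apply: einf_min => // e Ae; have [k' [eE _ _]] := AP e Ae.
    by rewrite eE lee_fin lez_nat; apply: kmin; apply/asboolP; rewrite -eE.
  have [k' [[kk'] _]] := AP _ Ak.
  by move: qpdE; rewrite qk gradeE => -[]; lia.
(* A chain of length d is found above an associated prime of M; it remains to bound all chains by
   d. *)
rewrite /cohen_macaulay depthM; apply/esym/dim_max.
  have [v v0] : exists v : M, v <> 0.
    by apply: contrapT => nv; apply: M_neq0 => v; apply: contrapT => v0; apply: nv; exists v.
  have [u umax _] := maximal_elt_above R_noetherian v0.
  have [c Hc c0] :=
    depth_chain R_noetherian R_local M_fg umax.1 (maximal_prime_elt umax) Dd.
  by apply: (chain_dims Hc) => a aM; apply/c0.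
(* The bottom prime of a chain above ann M contains l, so a chain of length g ends at it; the
   concatenated chain has length at most dim R = r <= g + d. *)
move=> n /dims_chain[c Hc Mc].
have [||b Hb bc] := regular_chain R_noetherian (p := c 0%N) _ _ rl.
- exact: Hc.1.
- by move=> x /lM/Mc.
have : (size l + n <= r)%N; last by lia.
apply: (dim_bound dimR); apply: (chain_dims (chain_cat Hb Hc bc)) => a /(_ (1 : R)).
rewrite -[_ *: _]/(a * 1) mulr1 => -> /=.
by have [[]] := Hb.1 0%N isT.
Qed.
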